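(* Let $0\le r\le n-1$ and let $\bar M^{n+1}$ be $\mathbb H^n\times\mathbb R$ or $\mathbb S^n\times\mathbb R$. Let $M^n\subset\bar M^{n+1}$ be an embedded rotational $H_{r+1}$-sphere, oriented so that it is positive definite. Then $M$ is not stable, i.e. there is no positive function $u\in C^\infty(M)$ with $T_ru\le0$ on $M$.
   Context: $\mathbb H^n$ and $\mathbb S^n$ are the hyperbolic space and the unit sphere, with the products carrying the Riemannian product metric. A rotational hypersurface in $\mathbb H^n\times\mathbb R$ or $\mathbb S^n\times\mathbb R$ is one that is foliated by horizontal geodesic spheres (geodesic spheres of the slices $\mathbb H^n\times\{t\}$, resp. $\mathbb S^n\times\{t\}$) centered at an axis $\{0\}\times\mathbb R$, where $0$ is a fixed point of $\mathbb H^n$, resp. $\mathbb S^n$ (with the foliation degenerating to points where the hypersurface meets the axis). A rotational $H_{r+1}$-sphere is a rotational $H_{r+1}$-hypersurface diffeomorphic to the $n$-sphere. For a hypersurface $M^n$ in an oriented Riemannian manifold $\bar M^{n+1}$ with unit normal field $N$ and Levi-Civita connection $\bar\nabla$ of $\bar M$, $A=-\bar\nabla N$ is its second fundamental form (self-adjoint operator on $TM$), with eigenvalues $\kappa_1,\dots,\kappa_n$. The (non normalized) $k$-mean curvatures are $H_0=1$, $H_k=\sum_{i_1<\dots<i_k}\kappa_{i_1}\cdots\kappa_{i_k}$ for $1\le k\le n$, $H_k=0$ for $k>n$. The Newton transformations are $P_0=I$, $P_r=H_rI-AP_{r-1}$. An $H_{r+1}$-hypersurface is one with $H_{r+1}$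 constant; it is positive definite if $P_r$ is positive definite at every point. $L_r(f)=\operatorname{trace}(P_r\operatorname{Hess}f)$. $\bar R_N(Y)=(\bar R(Y,N)N)^T$, where $\bar R$ is the curvature tensor of $\bar M$ (sign convention: $\langle\bar R(Y,N)N,Y\rangle$ is the sectional curvature of the plane spanned by orthonormal $Y,N$) and $(\cdot)^T$ is the tangential component. The stability operator is $T_r=L_r+\operatorname{trace}(A^2P_r)+\operatorname{trace}(P_r\bar R_N)$. A positive definite $H_{r+1}$-hypersurface $M$ is stable if there exists a positive function $u\in C^\infty(M)$ with $T_ru\le0$ on $M$. *)

(* Defs.v *)
From mathcomp Require Import all_boot all_order all_algebra.
From mathcomp Require Import all_classical all_reals all_analysis.
Import Order.TTheory GRing.Theory Num.Theory.
Import numFieldNormedType.Exports.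

Set Implicit Arguments.
Unset Strict Implicit.
Unset Printing Implicit Defensive.

Local Open Scope classical_set_scope.
Local Open Scope ring_scope.

Section Smoothness.
Variable R : realType.
Implicit Types V W : normedModType R.

Fixpoint is_Ck V W (k : nat) (U : set V) (f : V -> W) : Prop :=
  (forall x, U x -> {for x, continuous f}) /\
  match k with
  | 0%N => True
  | k'.+1 => forall v : V,
      (forall x, U x -> derivable f x v) /\ is_Ck k' U ('D_v f)
  end.

(* Meant for U open and V, W finite dimensional. *)
Definition smooth V W (U : set V) (f : V -> W) : Prop :=
  forall k, is_Ck k U f.

(* Smoothness on an arbitrary subset A of a vector space: f extends smoothly to
   a neighbourhood of each point of A. The values of f off A are irrelevant. *)
Definition smooth_map V W (A : set V) (f : V -> W) : Prop :=
  forall x, A x -> exists (U : set V) (F : V -> W),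
    [/\ open U, U x, smooth U F & forall y, A y -> U y -> F y = f y].

Definition diffeomorphic V W (A : set V) (B : set W) : Prop :=
  exists (f : V -> W) (g : W -> V),
    [/\ smooth_map A f, smooth_map B g,
        (forall x, A x -> B (f x)) /\ (forall y, B y -> A (g y)),
        (forall x, A x -> g (f x) = x) & (forall y, B y -> f (g y) = y)].

End Smoothness.

(* H^n is the upper sheet of the hyperboloid in Minkowski space R^{n,1}, S^n the
   unit sphere of R^{n+1}; the products with R lie in R^{n+1} x R. *)
Variant space_form := Hyperbolic | Spherical.

Section Ambient.
Variables (R : realType) (s : space_form) (n : nat).

Definition vec : normedModType R := 'rV[R]_n.+1.
Definition ambient : normedModType R := ('rV[R]_n.+1 * R^o)%type.

Definition sgn : R := if s is Hyperbolic then -1 else 1.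

Definition qform (x y : vec) : R :=
  sgn * (x 0 0 * y 0 0) + \sum_(i < n.+1 | i != 0) x 0 i * y 0 i.

Definition quadric : set vec :=
  [set x | qform x x = sgn /\ (s = Hyperbolic -> 0 < x 0 0)].

Definition Mbar : set ambient := [set p | quadric p.1].

(* Restricts to the Riemannian product metric on the tangent spaces of Mbar. *)
Definition inner (v w : ambient) : R := qform v.1 w.1 + v.2 * w.2.

(* For p in Mbar, the normal space of Mbar at p is spanned by (p.1, 0). *)
Definition tproj (p v : ambient) : ambient :=
  (v.1 - (sgn * qform v.1 p.1) *: p.1, v.2).

(* Levi-Civita connection of Mbar: the tangential part of the flat derivative.
   V and W are fields on the ambient space which are tangent to Mbar. *)
Definition cov (V W : ambient -> ambient) : ambient -> ambient :=
  fun p => tproj p ('D_(V p) W p).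

Definition lie (V W : ambient -> ambient) : ambient -> ambient :=
  fun p => 'D_(V p) W p - 'D_(W p) V p.

(* R(X,Y)Z = D_X D_Y Z - D_Y D_X Z - D_[X,Y] Z for X, Y, Z tangent to Mbar
   at p, extended to the tangent fields q |-> tproj q X, etc. With this sign
   <R(Y,N)N,Y> is the sectional curvature for orthonormal Y, N. *)
Definition curvature (p X Y Z : ambient) : ambient :=
  let Xf := tproj^~ X in let Yf := tproj^~ Y in let Zf := tproj^~ Z in
  cov Xf (cov Yf Zf) p - cov Yf (cov Xf Zf) p - cov (lie Xf Yf) Zf p.

End Ambient.
Arguments quadric {R} s {n}.
Arguments Mbar {R} s {n}.

Section Hypersurface.
Variables (R : realType) (s : space_form) (n : nat).
Local Notation ambient := (ambient R n).

Implicit Types (M : set ambient) (N : ambient -> ambient) (u : ambient -> R^o).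
Implicit Types (U : set 'rV[R]_n) (phi : 'rV[R]_n -> ambient) (x : 'rV[R]_n).

Definition local_param M U phi : Prop :=
  [/\ open U, smooth U phi,
      (exists W : set ambient, open W /\ phi @` U = M `&` W) &
      exists psi : ambient -> 'rV[R]_n,
        smooth_map (phi @` U) psi /\ forall x, U x -> psi (phi x) = x].

Definition embedded_hypersurface M : Prop :=
  M `<=` Mbar s /\
  forall p, M p -> exists U phi x, [/\ local_param M U phi, U x & phi x = p].

Definition partial (W : normedModType R) (i : 'I_n) (f : 'rV[R]_n -> W) :
  'rV[R]_n -> W := 'D_(delta_mx 0 i) f.

Definition unit_normal M N : Prop :=
  [/\ smooth_map M N,
      (forall p, M p -> tproj s p (N p) = N p),
      (forall p, M p -> inner s (N p) (N p) = 1) &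
      forall U phi, local_param M U phi -> forall x, U x ->
        forall i, inner s (N (phi x)) (partial i phi x) = 0].

(* From here on, an endomorphism T of the tangent space of M at phi x is
   represented by its matrix in the basis of the partial derivatives d_i phi x,
   with T (d_j phi) = \sum_i T i j *: d_i phi. *)

Definition induced_metric phi x : 'M[R]_n :=
  \matrix_(i, j) inner s (partial i phi x) (partial j phi x).

(* The matrix of d_j phi |-> (F j)^T, with ^T the component tangent to M. *)
Definition tangent_op phi x (F : 'I_n -> ambient) : 'M[R]_n :=
  invmx (induced_metric phi x) *m \matrix_(k, j) inner s (F j) (partial k phi x).

Definition shape_op N phi x : 'M[R]_n :=
  tangent_op phi x (fun j => - tproj s (phi x) (partial j (N \o phi) x)).

Definition curvature_op N phi x : 'M[R]_n :=
  tangent_op phi x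
    (fun j => curvature s (phi x) (partial j phi x) (N (phi x)) (N (phi x))).

(* The eigenvalues of A with multiplicity, when A has n real eigenvalues. *)
Definition eigenvals (A : 'M[R]_n) : 'rV[R]_n :=
  xget 0 [set k : 'rV[R]_n | char_poly A = \prod_i ('X - (k 0 i)%:P)].

Definition mean_curv (A : 'M[R]_n) (k : nat) : R :=
  \sum_(I : {set 'I_n} | #|I| == k) \prod_(i in I) eigenvals A 0 i.

Fixpoint newton (A : 'M[R]_n) (r : nat) : 'M[R]_n :=
  match r with
  | 0%N => 1%:M
  | r'.+1 => (mean_curv A r)%:M - A *m newton A r'
  end.

Definition christoffel phi x (k i j : 'I_n) : R :=
  2^-1 * \sum_l invmx (induced_metric phi x) k l *
    (partial i (fun y => induced_metric phi y j l : R^o) x +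
     partial j (fun y => induced_metric phi y i l : R^o) x -
     partial l (fun y => induced_metric phi y i j : R^o) x).

Definition hess_form phi (f : 'rV[R]_n -> R^o) x : 'M[R]_n :=
  \matrix_(i, j) (partial i (partial j f) x -
                  \sum_k christoffel phi x k i j * partial k f x).

Definition hess_op phi (f : 'rV[R]_n -> R^o) x : 'M[R]_n :=
  invmx (induced_metric phi x) *m hess_form phi f x.

Definition stability_op N (r : nat) u phi x : R :=
  let A := shape_op N phi x in
  let P := newton A r in
  \tr (P *m hess_op phi (u \o phi) x)
  + \tr (A *m A *m P) * u (phi x)
  + \tr (P *m curvature_op N phi x) * u (phi x).

Definition constant_mean_curv M N (k : nat) : Prop :=
  exists c : R, forall U phi, local_param M U phi -> forall x, U x ->
    mean_curv (shape_op N phi x) k = c.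

Definition newton_posdef M N (r : nat) : Prop :=
  forall U phi, local_param M U phi -> forall x, U x ->
  forall v : 'cV[R]_n, v != 0 ->
    0 < (v^T *m induced_metric phi x *m newton (shape_op N phi x) r *m v) 0 0.

Definition stable M N (r : nat) : Prop :=
  exists u : ambient -> R^o,
    [/\ smooth_map M u, (forall p, M p -> 0 < u p) &
        forall U phi, local_param M U phi -> forall x, U x ->
          stability_op N r u phi x <= 0].

(* The geodesic of H^n or S^n from o with unit initial velocity v. *)
Definition geodesic (o v : vec R n) (t : R) : vec R n :=
  if s is Hyperbolic
  then ((expR t + expR (- t)) / 2) *: o + ((expR t - expR (- t)) / 2) *: v
  else cos t *: o + sin t *: v.

Definition geodesic_sphere (o : vec R n) (rho t : R) : set ambient :=
  [set p | exists v : vec R n,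
     [/\ qform s v o = 0, qform s v v = 1 & p = (geodesic o v rho, t)]].

(* The leaves through points off the axis {o} x R are geodesic spheres, of
   radius less than the injectivity radius of the slice. In S^n x R the antipodal
   line {-o} x R is not part of the axis and lies on no such sphere, so M does not
   meet it; this excludes the slices S^n x {t}, which are stable for r = 0. *)
Definition rotational (o : vec R n) M : Prop :=
  forall p, M p ->
    p.1 = o \/
    exists rho t : R,
      [/\ 0 < rho, (s = Spherical -> rho < pi),
          geodesic_sphere o rho t p & geodesic_sphere o rho t `<=` M].

End Hypersurface.

Definition unit_sphere (R : realType) (n : nat) : set (vec R n) :=
  [set x | \sum_i x 0 i ^+ 2 = 1].
Arguments unit_sphere : clear implicits.

(* Main.v *)
Require Import Defs.
From HB Require Import structures.
From mathcomp Require Import all_boot all_order all_algebra.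
From mathcomp Require Import all_classical all_reals all_analysis.
From mathcomp Require Import ring lra.
From mathcomp Require complex.
Import Order.TTheory GRing.Theory Num.Theory.
Import numFieldNormedType.Exports.
Set Implicit Arguments.
Unset Strict Implicit.
Unset Printing Implicit Defensive.
Local Open Scope classical_set_scope.
Local Open Scope ring_scope.

(** A positive supersolution [u] is compared with a constant at its minimum.

    Suppose that [u > 0] satisfies [T_r u <= 0] on [M]. As [M] is compact, [u]
    has a minimum, at a point [p] where the gradient of [u] vanishes and its
    Hessian is nonnegative ([hess_form_min]). Since [P_r] is positive definite,
    the trace of [P_r Hess u] is nonnegative at [p], and therefore the trace of
    [P_r (A^2 + R_N)] is nonpositive there. Let [e_i] be an orthonormal basis of
    principal directions at [p], with principal curvatures [d_i]. It
    diagonalizes [P_r], with positive eigenvalues [p_i], and the trace is the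
    sum of the [p_i (d_i^2 + <R_N e_i, e_i>)]. The key fact ([jacobi_term]) is
    that each bracket is nonnegative, and zero only if [d_i = 0]. So [A = 0] at
    [p].

    In the spherical case the key fact holds because the sectional curvatures
    of the ambient space are nonnegative. In the hyperbolic case they are
    nonpositive, and rotational symmetry compensates for this
    ([hyperbolic_jacobi_term]). The fields generating the rotations about the
    axis are tangent to [M] ([normal_rotation]); differentiating their
    orthogonality to the normal determines the principal curvatures of the
    directions tangent to the leaves. For the leaf of radius [rho] they are, up
    to sign, [coth rho] times the length of the horizontal part of the normal.
    The curvature term is minus the square of that length, and [coth rho > 1].
    The remaining principal direction lies in a flat plane with the normal. On
    the axis itself the curvature term is zero.

    If [r > 0], then [A = 0] makes all mean curvatures of positive order vanish
    at [p], hence [P_r = 0] there, and [P_r] is not positive definite. If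
    [r = 0], then [H_1] is constant and vanishes at [p], so [M] is minimal. That
    is impossible for a compact rotational hypersurface ([no_minimal_sphere]):
    for suitable positive [lam] and [C] the function
    [exp (- lam <x, o>) + C t^2] of the point [(x, t)] has a positive Laplacian
    on [M], and cannot have a maximum.

    Everything is computed in a local parametrization. This rests on a calculus
    for functions of class C^k in finite dimension ([C1_differentiable],
    [is_Ck_comp], [schwarz], [second_derivative_test]), on the simultaneous
    diagonalization of the two fundamental forms
    ([simultaneous_diagonalization]), and on the expansion of ambient vectors in
    the frame made of the [e_i], the normal and the position vector
    ([adapted_expansion]). *)

(** * Symmetric real matrices *)

Section SpectralTheorem.
Import complex.
Variable R : rcfType.

Lemma mulmx_tr_ge0 n (v : 'rV[R]_n) : 0 <= (v *m v^T) 0 0.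
Proof. by rewrite mxE sumr_ge0// => i _; rewrite mxE -expr2 sqr_ge0. Qed.

Lemma mulmx_tr_eq0 n (v : 'rV[R]_n) : ((v *m v^T) 0 0 == 0) = (v == 0).
Proof.
apply/eqP/eqP => [|->]; last by rewrite mul0mx mxE.
rewrite mxE => /eqP; rewrite psumr_eq0 => [|i _]; last by rewrite mxE -expr2 sqr_ge0.
move=> /allP v0; apply/rowP => i; have := v0 i (mem_index_enum _).
by rewrite mxE -expr2 sqrf_eq0 mxE => /eqP.
Qed.

(** The spectral theorem over the complex numbers provides an eigenvalue, which
    is real because the matrix is hermitian. It is then a root of the real
    characteristic polynomial, and so it has a real eigenvector. *)
Lemma symmetric_eigenvector n (S : 'M[R]_n.+1) : S^T = S ->
  exists a (v : 'rV[R]_n.+1), v *m S = a *: v /\ v *m v^T = 1%:M.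
Proof.
move=> symS; pose C : numClosedFieldType := complex R.
pose f : {rmorphism R -> C} := real_complex R.
pose SC : 'M[C]_n.+1 := map_mx f S.
have hS : SC \is hermsymmx.
  apply: realsym_hermsym.
    by apply/is_hermitianmxP; rewrite expr0 scale1r map_mx_id// /SC map_trmx symS.
  apply/mxOverP => i j; rewrite mxE; apply/complex_realP.
  by exists (S i j).
have D_real := hermitian_spectral_diag_real hS.
have /orthomx_spectralP SE := hermitian_normalmx hS.
set P := spectralmx SC in SE; set D := spectral_diag SC in SE D_real.
have Pu : P \in unitmx := spectral_unit SC.
have [a aE] : exists a : R, D 0 0 = f a.
  have /mxOverP/(_ 0 0)/complex_realP[a ->] := D_real; by exists a.
have : eigenvalue SC (f a).
  apply/eigenvalueP; exists (row 0 P).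
    rewrite SE -row_mul !mulmxA mulmxV// mul1mx.
    by apply/rowP => j; rewrite mul_diag_mx !mxE aE.
  apply: contraTneq Pu => P0; rewrite unitmxE unitfE.
  suff -> : \det P = 0 by rewrite eqxx.
  by rewrite (expand_det_row _ 0) big1// => j _; move/rowP/(_ j): P0; rewrite !mxE => ->; rewrite mul0r.
rewrite eigenvalue_root_char -map_char_poly fmorph_root -eigenvalue_root_char.
move=> /eigenvalueP[v vS v0]; exists a.
pose c := (v *m v^T) 0 0; have c_gt0 : 0 < c.
  by rewrite lt_def mulmx_tr_ge0 andbT mulmx_tr_eq0.
exists ((Num.sqrt c)^-1 *: v); split.
  by rewrite -scalemxAl vS !scalerA mulrC.
rewrite linearZ/= -scalemxAl -scalemxAr scalerA -invfM -expr2 sqr_sqrtr ?ltW//.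
by rewrite [v *m _]mx11_scalar -/c scale_scalar_mx mulVf ?gt_eqF.
Qed.

(** The Householder reflection in the hyperplane orthogonal to the difference of
    [v] and the first basis vector exchanges these two vectors. *)
Lemma orthogonal_mx_first_row n (v : 'rV[R]_n.+1) : v *m v^T = 1%:M ->
  exists H : 'M[R]_n.+1, H *m H^T = 1%:M /\ delta_mx 0 0 *m H = v.
Proof.
move=> v1; pose e : 'rV[R]_n.+1 := delta_mx 0 0; pose w := e - v.
have [w0|w_neq0] := eqVneq w 0.
  by exists 1%:M; rewrite trmx1 !mulmx1; split=> //; apply/eqP; rewrite -subr_eq0 -/e -/w w0.
pose c := (w *m w^T) 0 0.
have c_neq0 : c != 0 by rewrite mulmx_tr_eq0.
have wwE : w *m w^T = c%:M by rewrite [LHS]mx11_scalar.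
have ee : e *m e^T = 1%:M by rewrite trmx_delta mul_delta_mx; apply/matrixP => i j; rewrite !ord1 !mxE.
have cE : c = 2 * (e *m w^T) 0 0.
  rewrite /c /w [(_ - _)^T]linearB/= mulmxBl !mulmxBr ee v1.
  have -> : v *m e^T = e *m v^T.
    by rewrite -[LHS]trmxK trmx_mul trmxK [LHS]mx11_scalar [X in _ = X]mx11_scalar mxE.
  by rewrite !mxE !eqxx; ring.
pose H := 1%:M - (2 / c) *: (w^T *m w).
have HT : H^T = H by rewrite /H linearB/= trmx1 linearZ/= trmx_mul trmxK.
exists H; split.
  rewrite HT /H; set K := w^T *m w.
  have KK : K *m K = c *: K.
    by rewrite /K mulmxA -[w^T *m w *m w^T]mulmxA wwE mul_mx_scalar scalemxAl.
  rewrite mulmxBl mul1mx mulmxBr mulmx1 -scalemxAl -scalemxAr KK !scalerA.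
  have -> : 2 / c * (2 / c) * c = 2 / c + 2 / c by field.
  by rewrite scalerDl opprB addrK subrK.
rewrite /H mulmxBr mulmx1 -scalemxAr mulmxA [e *m _]mx11_scalar mul_scalar_mx scalerA.
have -> : 2 / c * (e *m w^T) 0 0 = 1 by rewrite mulrAC -cE divff.
by rewrite scale1r /w subKr.
Qed.

(** By induction on the size: an orthogonal matrix whose first row is a unit
    eigenvector splits off a block of size one. *)
Theorem symmetric_diagonalization n (S : 'M[R]_n) : S^T = S ->
  exists (O : 'M[R]_n) (d : 'rV[R]_n),
    O *m O^T = 1%:M /\ O *m S *m O^T = diag_mx d.
Proof.
elim: n S => [|n IHn] S symS.
  by exists 1%:M, 0; split; apply/matrixP => -[].
have [a [v [vS v1]]] := symmetric_eigenvector symS.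
have [H [HHT eH]] := orthogonal_mx_first_row v1.
have HTH : H^T *m H = 1%:M by apply: mulmx1C.
pose S' : 'M[R]_n.+1 := H *m S *m H^T.
have symS' : S'^T = S' by rewrite /S' !trmx_mul trmxK symS mulmxA.
have eS' : (delta_mx 0 0 : 'rV_n.+1) *m S' = a *: delta_mx 0 0.
  by rewrite /S' !mulmxA eH vS -scalemxAl -eH -mulmxA HHT mulmx1.
have S'def : H *m S *m H^T = S' by [].
clearbody S'.
have S'0 j : S' 0 j = a * (j == 0)%:R.
  by move/rowP: eS' => /(_ j); rewrite -rowE !mxE eqxx.
have S'E : (S' : 'M[R]_(1 + n)) = block_mx a%:M 0 0 (drsubmx (S' : 'M[R]_(1 + n))).
  apply: etrans (esym (@submxK _ 1 n 1 n S')) _; congr block_mx.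
  - apply/matrixP => i j; rewrite !ord1 !mxE.
    apply: (@etrans _ _ (S' 0 0)); last by rewrite S'0 ?mulr1.
    by apply: (congr2 (fun i j => S' i j)); apply: val_inj.
  - apply/matrixP => i j; rewrite !ord1 !mxE.
    apply: (@etrans _ _ (S' 0 (rshift 1 j))); last by rewrite S'0 ?mulr0.
    by apply: (congr2 (fun i j => S' i j)); apply: val_inj.
  - apply/matrixP => i j; rewrite !ord1 !mxE -[S']symS' mxE.
    apply: (@etrans _ _ (S' 0 (rshift 1 i))); last by rewrite S'0 ?mulr0.
    by apply: (congr2 (fun i j => S' i j)); apply: val_inj.
have [] := IHn (drsubmx (S' : 'M[R]_(1 + n))); first by rewrite trmx_drsub symS'.
move=> O [d [OOT OS]].
pose B : 'M[R]_(1 + n) := block_mx 1%:M 0 0 O.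
have BT : B^T = block_mx 1%:M 0 0 O^T by rewrite /B tr_block_mx !trmx0 trmx1.
have BBT : B *m B^T = 1%:M.
  rewrite BT mulmx_block !(mul0mx, mulmx0, addr0, add0r) OOT mulmx1.
  by rewrite -scalar_mx_block.
have BS : B *m (S' : 'M[R]_(1 + n)) *m B^T = diag_mx (row_mx a%:M d).
  rewrite S'E BT !mulmx_block !(mul0mx, mulmx0, mul1mx, mulmx1, addr0, add0r).
  rewrite OS diag_mx_row; congr block_mx.
  by apply/matrixP => i j; rewrite !ord1 !mxE.
clearbody B; exists ((B : 'M[R]_n.+1) *m H), (row_mx a%:M d); split.
  by rewrite trmx_mul mulmxA -[_ *m H *m _]mulmxA HHT mulmx1.
by rewrite trmx_mul mulmxA -[_ *m H *m S]mulmxA -[X in X *m _]mulmxA S'def.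
Qed.

End SpectralTheorem.

(** * Simultaneous diagonalization of two quadratic forms *)

Section Pencil.
Variable R : realType.

Definition posdef_mx n (G : 'M[R]_n) : Prop :=
  forall v : 'cV[R]_n, v != 0 -> 0 < (v^T *m G *m v) 0 0.

(** An orthogonal matrix diagonalizes [G], and rescaling its columns turns [G]
    into the identity. The transformed [B] is still symmetric; diagonalizing it
    by a second orthogonal matrix does not disturb the identity. *)
Lemma simultaneous_diagonalization n (G B : 'M[R]_n) :
  G^T = G -> posdef_mx G -> B^T = B ->
  exists (E : 'M[R]_n) (d : 'rV[R]_n),
    E^T *m G *m E = 1%:M /\ E^T *m B *m E = diag_mx d.
Proof.
move=> symG posG symB.
have [Q [g [QQT QG]]] := symmetric_diagonalization symG.
have g_gt0 i : 0 < g 0 i.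
  have := posG (Q^T *m delta_mx i 0).
  rewrite trmx_mul trmxK mulmxA -[_ *m Q *m G]mulmxA -[_ *m (Q *m G) *m _]mulmxA.
  rewrite QG trmx_delta -rowE -!colE !mxE eqxx mulr1n; apply.
  apply/eqP => /(congr1 (mulmx Q)); rewrite colE mulmxA QQT mul1mx mulmx0.
  by move/matrixP/(_ i 0); rewrite !mxE !eqxx => /eqP; rewrite oner_eq0.
pose s : 'rV[R]_n := \row_i (Num.sqrt (g 0 i))^-1.
pose E0 := Q^T *m diag_mx s.
have E0G : E0^T *m G *m E0 = 1%:M.
  rewrite /E0 trmx_mul trmxK tr_diag_mx !mulmxA -2!(mulmxA (diag_mx s)) QG.
  rewrite -mulmxA !mulmx_diag -diag_const_mx; congr diag_mx.
  apply/rowP => i; rewrite !mxE mulrCA -invfM -expr2 sqr_sqrtr ?ltW//.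
  by rewrite mulfV ?gt_eqF.
clearbody E0.
have symB' : (E0^T *m B *m E0)^T = E0^T *m B *m E0.
  by rewrite !trmx_mul trmxK symB mulmxA.
have [Q' [d [Q'QT Q'B]]] := symmetric_diagonalization symB'.
exists (E0 *m Q'^T), d; split; rewrite trmx_mul trmxK !mulmxA.
  by rewrite -2!(mulmxA Q') E0G mulmx1.
by move: Q'B; rewrite !mulmxA.
Qed.

Variables (n : nat) (G B E : 'M[R]_n) (d : 'rV[R]_n).
Hypotheses (EG : E^T *m G *m E = 1%:M) (EB : E^T *m B *m E = diag_mx d).
Let A := invmx G *m B.

Lemma pencil_mulVmx : E *m (E^T *m G) = 1%:M.
Proof. exact: mulmx1C. Qed.

Lemma pencil_unitmx : E \in unitmx.
Proof. by have [] := mulmx1_unit pencil_mulVmx. Qed.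

Lemma pencil_invmx : invmx G = E *m E^T.
Proof.
have h : E *m E^T *m G = 1%:M by rewrite -mulmxA pencil_mulVmx.
have [_ uG] := mulmx1_unit h.
by rewrite -[RHS]mulmx1 -(mulmxV uG) mulmxA h mul1mx.
Qed.

Lemma pencil_eigen : A *m E = E *m diag_mx d.
Proof. by rewrite /A pencil_invmx -!mulmxA (mulmxA E^T) EB. Qed.

Lemma pencil_char_poly : char_poly A = \prod_i ('X - (d 0 i)%:P).
Proof.
have trigD : is_trig_mx (diag_mx d) by apply: diag_mx_is_trig.
have -> : \prod_i ('X - (d 0 i)%:P) = char_poly (diag_mx d).
  by rewrite char_poly_trig//; apply: eq_bigr => i _; rewrite mxE eqxx mulr1n.
have := congr1 (map_mx (@polyC R)) pencil_eigen.
rewrite map_mxM [in RHS]map_mxM/= => eigE; set EP := map_mx _ E in eigE.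
have EP0 : \det EP != 0.
  by rewrite det_map_mx polyC_eq0 -unitfE -unitmxE pencil_unitmx.
apply: (mulIf EP0); rewrite [RHS]mulrC -!det_mulmx; congr (\det _).
by rewrite /char_poly_mx mulmxBl mulmxBr eigE -scalar_mxC.
Qed.

(** The choice made in [eigenvals] falls back to 0 when the characteristic
    polynomial does not split. Here it splits, so the chosen values are the
    eigenvalues. *)
Lemma pencil_eigenvals :
  char_poly A = \prod_i ('X - (eigenvals A 0 i)%:P).
Proof.
rewrite /eigenvals; case: xgetP => [k -> //|/(_ d)/= []].
exact: pencil_char_poly.
Qed.

Lemma pencil_tr (p : 'rV[R]_n) (X : 'M[R]_n) :
  X *m E = E *m diag_mx p -> \tr X = \sum_i p 0 i.
Proof.
move=> XE; have -> : X = E *m diag_mx p *m (E^T *m G).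
  by rewrite -XE -mulmxA pencil_mulVmx mulmx1.
by rewrite -mulmxA mxtrace_mulC -mulmxA EG mulmx1 mxtrace_diag.
Qed.

Lemma pencil_mean_curv1 : mean_curv A 1 = \sum_i d 0 i.
Proof.
rewrite -(pencil_tr pencil_eigen).
have -> : \tr A = \sum_i eigenvals A 0 i.
  rewrite -mxtrace_diag; have [n0|n_gt0] := posnP n.
    by rewrite /mxtrace !big1// => i _; have /ltn_geF := leq_ltn_trans (leq0n i) (ltn_ord i); rewrite [X in (X <= _)%N]n0.
  have tr_char (X : 'M[R]_n) : \tr X = - (char_poly X)`_n.-1.
    by rewrite char_poly_trace// opprK.
  have eqA : char_poly A = char_poly (diag_mx (eigenvals A)).
    rewrite pencil_eigenvals char_poly_trig ?diag_mx_is_trig//.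
    by apply: eq_bigr => i _; rewrite mxE eqxx mulr1n.
  by rewrite (tr_char A) eqA -tr_char.
rewrite /mean_curv (eq_bigl (mem [set [set i]%SET | i in 'I_n]%SET)); last first.
  move=> I /=; apply/cards1P/imsetP => [[i ->]|[i _ ->]]; exists i => //.
rewrite big_imset/=; last by move=> i j _ _; apply: set1_inj.
by apply: eq_bigr => i _; rewrite big_set1.
Qed.

Section NewtonPolynomial.
Variables (P : 'M[R]_n) (p : 'rV[R]_n).
Hypothesis PE : P *m E = E *m diag_mx p.

(** The inverse of [G] is [E *m E^T], so the trace of an operator obtained from
    a form [X] by raising an index is computed on the basis given by the columns
    of [E]. *)
Lemma pencil_tr_form (X : 'M[R]_n) :
  \tr (P *m (invmx G *m X)) = \sum_i p 0 i * (E^T *m X *m E) i i.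
Proof.
rewrite pencil_invmx -(mulmxA E) (mulmxA P E) PE -(mulmxA E) mxtrace_mulC -(mulmxA (diag_mx p)).
by apply: eq_bigr => i _; rewrite mul_diag_mx mxE.
Qed.

Lemma pencil_tr_sqr : \tr (A *m A *m P) = \sum_i p 0 i * d 0 i ^+ 2.
Proof.
rewrite (@pencil_tr (\row_i (p 0 i * d 0 i ^+ 2))); first by apply: eq_bigr => i _; rewrite mxE.
rewrite -(mulmxA _ P) PE (mulmxA _ E) -(mulmxA A A) pencil_eigen (mulmxA A E) pencil_eigen -!(mulmxA E) !mulmx_diag.
by congr (_ *m diag_mx _); apply/rowP => i; rewrite !mxE; ring.
Qed.

Lemma pencil_posdef_gt0 i : posdef_mx (G *m P) -> 0 < p 0 i.
Proof.
move=> /(_ (col i E)); have -> : col i E = E *m delta_mx i 0 by rewrite -colE.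
have -> : (E *m delta_mx i (0 : 'I_1))^T *m (G *m P) *m (E *m delta_mx i (0 : 'I_1)) =
    delta_mx 0 i *m (E^T *m G *m E *m diag_mx p) *m delta_mx i 0.
  by rewrite -(mulmxA (E^T *m G)) -PE trmx_mul trmx_delta !mulmxA.
rewrite EG mul1mx -rowE -!colE !mxE.
rewrite eqxx mulr1n; apply; apply/eqP => /(congr1 (mulmx (E^T *m G))).
rewrite mulmx0 colE mulmxA EG mul1mx => /matrixP/(_ i 0); rewrite !mxE !eqxx/=.
by move/eqP; rewrite oner_eq0.
Qed.
End NewtonPolynomial.

End Pencil.

(** * Mean curvatures and Newton transformations of a matrix *)

Section NewtonTransformations.
Variables (R : realType) (n : nat).

Lemma mean_curv0 k : mean_curv (0 : 'M[R]_n) k.+1 = 0.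
Proof.
have eig0 i : eigenvals (0 : 'M[R]_n) 0 i = 0.
  rewrite /eigenvals; case: xgetP => [k' _ kE|_]; last by rewrite mxE.
  have : root (char_poly (0 : 'M[R]_n)) (k' 0 i).
    by rewrite kE rootE horner_prod (bigD1 i)//= hornerXsubC subrr mul0r.
  rewrite -eigenvalue_root_char => /eigenvalueP[v]; rewrite mulmx0 => /esym/eqP.
  by rewrite scaler_eq0 => /orP[/eqP//|/eqP ->]; rewrite eqxx.
rewrite /mean_curv big1// => I /eqP cI.
have [i iI] : exists i, i \in I by apply/set0Pn; rewrite -card_gt0 cI.
by rewrite (bigD1 i)//= eig0 mul0r.
Qed.

(** A totally geodesic point is incompatible with a positive definite Newton
    transformation of positive order. *)
Lemma newton0 r : newton (0 : 'M[R]_n) r.+1 = 0.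
Proof.
by elim: r => [|r IHr] /=; rewrite mul0mx subr0 mean_curv0 raddf0.
Qed.

Lemma newton_eigen (A E : 'M[R]_n) (d : 'rV[R]_n) r :
  A *m E = E *m diag_mx d -> exists p, newton A r *m E = E *m diag_mx p.
Proof.
move=> AE; elim: r => [|r [p IHr]].
  by exists (const_mx 1); rewrite mul1mx diag_const_mx mulmx1.
exists (const_mx (mean_curv A r.+1) - \row_j (d 0 j * p 0 j)).
rewrite [newton _ _]/= mulmxBl -mulmxA IHr mulmxA AE -mulmxA mulmx_diag.
by rewrite linearB/= diag_const_mx mulmxBr scalar_mxC.
Qed.

End NewtonTransformations.

(** * Directional derivatives *)

Section DirectionalDerivatives.
Variable R : realType.
Implicit Types V W : normedModType R.

Lemma is_derive_linear V W W' (l : {linear W -> W'}) (f : V -> W) x v df :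
  continuous l -> is_derive x v f df -> is_derive x v (l \o f) (l df).
Proof.
move=> cl [fxv <-].
have h : (fun h => h^-1 *: (((l \o f) \o shift x) (h *: v) - (l \o f) x)) =
   l \o (fun h => h^-1 *: ((f \o shift x) (h *: v) - f x)).
  by apply/funext => h; rewrite /= -(raddfB l) -linearZ.
have c : (fun h => h^-1 *: (((l \o f) \o shift x) (h *: v) - (l \o f) x)) @ 0^'
    --> l ('D_v f x).
  rewrite h. apply: (@cvg_comp _ _ _ _ l _ _ _ _ (cl _)); exact: fxv.
by apply: DeriveDef; [apply/cvg_ex; exists (l ('D_v f x)) | exact: cvg_lim c].
Qed.

(** Restricting [c] to the line through [x] along [v] reduces the claim to the
    chain rule for maps that are differentiable in the sense of Frechet, since a
    curve is differentiable as soon as it is derivable. *)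
Lemma is_derive_comp V W W' (f : W -> W') (c : V -> W) x v :
  derivable c x v -> differentiable f (c x) ->
  is_derive x v (f \o c) ('D_('D_v c x) f (c x)).
Proof.
move=> /derivable1P; set g := fun h : R => _ => dg df.
have g0 : g 0 = c x by rewrite /g scale0r add0r.
have dfg : differentiable f (g 0) by rewrite g0.
have [dg' dgf] : differentiable g 0 /\ differentiable (f \o g) 0.
  have dg' : differentiable g 0 by apply/derivable1_diffP.
  by split=> //; apply: differentiable_comp.
have E1 W0 (F : V -> W0) : 'D_v F x = 'D_1 (fun h : R => F (h *: v + x)) 0.
  rewrite /derive (_ : (fun h : R => h^-1 *: ((F \o shift x) (h *: v) - F x)) =
    (fun h : R => h^-1 *: (((fun h : R => F (h *: v + x)) \o shift 0) (h *: 1)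
      - F (0 *: v + x))))//; apply/funext => h /=.
  by rewrite scale0r add0r addr0 [h *: 1]mulr1.
apply: DeriveDef; first by apply/derivable1P/derivable1_diffP.
rewrite !E1 -/g (_ : (fun h => _) = f \o g)// !deriveE//.
  by rewrite diff_comp//= g0.
Qed.

Lemma is_derive_line V W (f : V -> W) (y b : V) (s t : R) :
  derivable f (y + (s * t) *: b) b ->
  is_derive s 1 (fun s => f (y + (s * t) *: b)) (t *: 'D_b f (y + (s * t) *: b)).
Proof.
move=> /[dup] dfb /derivable1P; set z := y + _; set g := fun h : R => _.
move=> /derivable1_diffP dg.
have -> : (fun s => f (y + (s * t) *: b)) = g \o (fun s' => (s' - s) * t).
  apply/funext => s' /=; rewrite /g /z addrCA -scalerDl; congr (f (_ + _ *: _)).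
  by ring.
have [d1 d2] : is_derive s 1 (fun s' => (s' - s) * t) t.
  have -> : (fun s' => (s' - s) * t) = t \*: (fun s' : R => (s' - s : R^o)).
    by apply/funext => s' /=; rewrite mulrC.
  apply: is_derive_eq; rewrite subr0; exact: mulr1.
have h0 : (s - s) * t = 0 by rewrite subrr mul0r.
have := @is_derive_comp _ _ _ g (fun s' => (s' - s) * t) s 1 d1.
rewrite h0 d2 => /(_ dg) dgc; apply: is_derive_eq dgc _.
rewrite (deriveE _ dg) -[X in 'd g 0 X]mulr1 [LHS]linearZ; congr (_ *: _).
rewrite -(deriveE _ dg) /derive (_ : (fun h : R => h^-1 *: ((g \o shift 0) (h *: 1) - g 0)) =
  (fun h : R => h^-1 *: ((f \o shift z) (h *: b) - f z)))//; apply/funext => h /=.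
by rewrite /g /= scale0r add0r addr0 [h *: 1]mulr1.
Qed.

(** The sign of [t] is arbitrary, so that both directions along the line are
    covered. *)
Lemma mean_value_line V (f : V -> R^o) (y b : V) (t : R) :
  (forall s, 0 <= s <= 1 -> derivable f (y + (s * t) *: b) b) ->
  exists2 s, 0 < s < 1 &
    f (y + t *: b) - f y = t * 'D_b f (y + (s * t) *: b).
Proof.
move=> df; pose g s := f (y + (s * t) *: b).
have [||c] := @MVT R g (fun s => t * 'D_b f (y + (s * t) *: b)) 0 1 ltr01.
- move=> s; rewrite in_itv/= => /andP[s0 s1].
  by apply: is_derive_line; apply: df; rewrite !ltW.
- apply: derivable_within_continuous => s; rewrite in_itv/= => s01.
  by have [] := is_derive_line (df _ s01).
rewrite in_itv/= subr0 mulr1 /g mul1r mul0r scale0r addr0 => c01 ->.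
by exists c.
Qed.

End DirectionalDerivatives.

(** * Functions of class C^k *)

(** A finite basis with continuous coordinates. It expresses finite dimension in
    a way that covers row vectors, the product with a line and the scalars at
    the same time. *)
Record frame (R : realType) (V : normedModType R) := Frame {
  frame_index : finType;
  frame_vec : frame_index -> V;
  frame_coord : frame_index -> {linear V -> R^o};
  frame_coord_continuous : forall i, continuous (frame_coord i);
  frame_sum : forall v, v = \sum_i frame_coord i v *: frame_vec i
}.

Section CkFunctions.
Variable R : realType.
Implicit Types V W : normedModType R.

Lemma is_Ck_sub V W k (U U' : set V) (f : V -> W) :
  U' `<=` U -> is_Ck k U f -> is_Ck k U' f.
Proof.
move=> sub; elim: k f => [|k IHk] f /= [cf df]; split=> //.
- by move=> x /sub/cf.
- by move=> x /sub/cf.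
by move=> v; have [dv /IHk] := df v; split=> // x /sub/dv.
Qed.

Lemma near_eq_open V W (U : set V) (f g : V -> W) x :
  open U -> U x -> (forall x, U x -> f x = g x) -> \near x, f x = g x.
Proof. by move=> oU Ux fg; near do apply: fg; exact: open_nbhs_nbhs. Unshelve. all: by end_near. Qed.

Lemma continuous_eq_open V W (U : set V) (f g : V -> W) x :
  open U -> U x -> (forall x, U x -> f x = g x) ->
  {for x, continuous f} -> {for x, continuous g}.
Proof.
move=> oU Ux fg cf; have cfx : f @ x --> f x := cf.
suff : g @ x --> g x by [].
rewrite -fg//; apply: cvg_trans cfx; apply: near_eq_cvg.
exact: near_eq_open oU Ux fg.
Qed.

(** Outside [U] the functions may differ; the derivatives agree on [U] because
    [U] is open. *)
Lemma is_Ck_ext V W k (U : set V) (f g : V -> W) :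
  open U -> (forall x, U x -> f x = g x) -> is_Ck k U f -> is_Ck k U g.
Proof.
move=> oU; elim: k f g => [|k IHk] f g fg /= [cf df].
  by split=> // x Ux; apply: continuous_eq_open oU Ux fg (cf _ Ux).
split=> [x Ux|v]; first exact: continuous_eq_open oU Ux fg (cf _ Ux).
have [dv ck] := df v; split=> [x Ux|].
  by apply: near_eq_derivable (dv _ Ux); exact: near_eq_open oU Ux fg.
apply: IHk ck => x Ux.
by apply: near_eq_derive; exact: near_eq_open oU Ux fg.
Qed.

Lemma is_Ck_pred V W k (U : set V) (f : V -> W) : is_Ck k.+1 U f -> is_Ck k U f.
Proof.
elim: k f => [|k IHk] f; first by case.
move=> [cf df]; split=> // v; have [dv ck] := df v; split=> //.
exact: IHk.
Qed.

Lemma is_Ck_le V W k m (U : set V) (f : V -> W) :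
  (m <= k)%N -> is_Ck k U f -> is_Ck m U f.
Proof.
move=> /subnK <-; elim: (k - m)%N => [//|j IHj].
by rewrite addSn => /is_Ck_pred.
Qed.

Lemma is_Ck_derivable V W k (U : set V) (f : V -> W) x v :
  is_Ck k.+1 U f -> U x -> derivable f x v.
Proof. by move=> [_ /(_ v)[df _]]; exact: df. Qed.

Lemma is_Ck_derive V W k (U : set V) (f : V -> W) v :
  is_Ck k.+1 U f -> is_Ck k U ('D_v f).
Proof. by move=> [_ /(_ v)[]]. Qed.

Lemma is_Ck_linear V W W' k (U : set V) (l : {linear W -> W'}) (f : V -> W) :
  open U -> continuous l -> is_Ck k U f -> is_Ck k U (l \o f).
Proof.
move=> oU cl; elim: k f => [|k IHk] f /= [cf df].
  by split=> // x Ux; apply: continuous_comp; [exact: cf|exact: cl].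
split=> [x Ux|v].
  by apply: continuous_comp; [exact: cf|exact: cl].
have [dv ck] := df v; split=> [x Ux|].
  by have [] := is_derive_linear cl (derivableP (dv _ Ux)).
apply: (is_Ck_ext oU _ (IHk _ ck)) => x Ux.
by have [_ ->] := is_derive_linear cl (derivableP (dv _ Ux)).
Qed.

Lemma is_Ck_cst V W k (U : set V) (a : W) : is_Ck k U (cst a : V -> W).
Proof.
elim: k a => [|k IHk] a; first by split=> // x _; exact: cst_continuous.
split=> [x _|v]; first exact: cst_continuous.
split=> [x _|]; first exact: derivable_cst.
rewrite (_ : 'D_v _ = cst 0); first exact: IHk.
by apply/funext => x; rewrite derive_cst.
Qed.

Lemma is_Ck_add V W k (U : set V) (f g : V -> W) :
  open U -> is_Ck k U f -> is_Ck k U g -> is_Ck k U (f + g).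
Proof.
move=> oU; elim: k f g => [|k IHk] f g /= [cf df] [cg dg].
  by split=> // x Ux; apply: continuousD; [exact: cf|exact: cg].
split=> [x Ux|v].
  by apply: continuousD; [exact: cf|exact: cg].
have [dfv fk] := df v; have [dgv gk] := dg v; split=> [x Ux|].
  by apply: derivableD; [exact: dfv | exact: dgv].
apply: (is_Ck_ext oU _ (IHk _ _ fk gk)) => x Ux.
by rewrite deriveD//; [exact: dfv | exact: dgv].
Qed.

Lemma is_Ck_sum V W k (U : set V) (I : Type) (s : seq I) (f : I -> V -> W) :
  open U -> (forall i, is_Ck k U (f i)) -> is_Ck k U (\sum_(i <- s) f i).
Proof.
move=> oU fk; elim/big_ind: _ => //; first exact: is_Ck_cst.
by move=> g h; exact: is_Ck_add.
Qed.

Lemma is_Ck_mul V k (U : set V) (f g : V -> R^o) :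
  open U -> is_Ck k U f -> is_Ck k U g -> is_Ck k U (f * g).
Proof.
move=> oU; elim: k f g => [|k IHk] f g fk gk.
  split=> // x Ux; have [/(_ x Ux) cf _] := fk; have [/(_ x Ux) cg _] := gk.
  exact: continuousM.
split=> [x Ux|v].
  have [/(_ x Ux) cf _] := fk; have [/(_ x Ux) cg _] := gk.
  exact: continuousM.
have dfv x Ux := @is_Ck_derivable _ _ _ _ _ x v fk Ux.
have dgv x Ux := @is_Ck_derivable _ _ _ _ _ x v gk Ux.
split=> [x Ux|]; first by apply: derivableM; [exact: dfv | exact: dgv].
have h := is_Ck_add oU (IHk _ _ (is_Ck_pred fk) (is_Ck_derive v gk))
  (IHk _ _ (is_Ck_pred gk) (is_Ck_derive v fk)).
apply: (is_Ck_ext oU _ h) => x Ux.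
by rewrite deriveM//; [exact: dfv | exact: dgv].
Qed.

End CkFunctions.

(** * Differentiability from continuous partial derivatives *)

Section FrechetDifferentiability.
Variables (R : realType) (V : normedModType R) (e : frame V).
Local Notation I := (frame_index e).
Local Notation b := (@frame_vec _ _ e).
Local Notation c := (@frame_coord _ _ e).

(** The increment is decomposed into moves along one basis vector at a time,
    each of them controlled by the mean value theorem. The bound on the total
    length keeps all intermediate points in the ball. *)
Lemma C1_increment (f : V -> R^o) (x : V) (rho eps : R) (s : seq I) (t : I -> R) :
  (forall z, `|z - x| < rho -> forall i, derivable f z (b i) /\
     `|'D_(b i) f z - 'D_(b i) f x| <= eps) ->
  \sum_(i <- s) `|t i| * `|b i| < rho ->
  `|f (x + \sum_(i <- s) t i *: b i) - f x - \sum_(i <- s) t i * 'D_(b i) f x|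
    <= eps * \sum_(i <- s) `|t i|.
Proof.
move=> near_x; elim: s => [|i s IHs].
  by rewrite !big_nil addr0 subrr subr0 normr0 mulr0.
rewrite !big_cons => small.
have small_s : \sum_(j <- s) `|t j| * `|b j| < rho.
  by apply: le_lt_trans small; rewrite lerDr mulr_ge0.
have near_line (a : R) : 0 <= a <= 1 ->
    `|x + \sum_(j <- s) t j *: b j + (a * t i) *: b i - x| < rho.
  move=> /andP[a0 a1]; rewrite addrAC [x + _]addrC addrK.
  apply: le_lt_trans small; rewrite addrC; apply: le_trans (ler_normD _ _) _.
  apply: lerD.
    by rewrite normrZ normrM (ger0_norm a0) ler_wpM2r// ler_piMl.
  apply: le_trans (ler_norm_sum _ _ _) _.
  by apply: ler_sum => j _; rewrite normrZ.
have [a a01 fE] := @mean_value_line R V f (x + \sum_(j <- s) t j *: b j) (b i) (t i)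
  (fun a a01 => (near_x _ (near_line a a01) i).1).
rewrite [t i *: _ + _]addrC addrA.
have regroup (p q r u w : R) : p - q - (r + w) = (p - u - r) + (u - q - w) by ring.
rewrite (regroup _ _ _ (f (x + \sum_(j <- s) t j *: b j))).
rewrite mulrDr; apply: le_trans (ler_normD _ _) (lerD _ (IHs small_s)).
rewrite fE -mulrBr normrM [leRHS]mulrC ler_wpM2l//.
have /andP[a0 a1] := a01.
by apply: (near_x _ (near_line a _) i).2; rewrite !ltW.
Qed.

(** By continuity of the partial derivatives, the constant [eps] of
    [C1_increment] can be made arbitrarily small on small balls. *)
Lemma C1_differentiable (f : V -> R^o) (U : set V) x :
  open U -> is_Ck 1 U f -> U x -> differentiable f x.
Proof.
move=> oU Cf Ux.
pose df (h : V) : R^o := \sum_i c i h *: 'D_(b i) f x.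
have df_lin : linear df.
  move=> a u v; rewrite /df scaler_sumr -big_split/=; apply: eq_bigr => i _.
  by rewrite linearP scalerDl scalerA.
pose dfM := GRing.isLinear.Build _ _ _ _ df df_lin.
pose dfL : {linear V -> R^o} := HB.pack df dfM.
have df_cont : continuous dfL.
  have -> : (dfL : V -> R^o) = \sum_i (fun h : V => c i h *: 'D_(b i) f x : R^o).
    by apply/funext => h; rewrite fct_sumE.
  elim/big_ind: _ => [|g g' cg cg' h|i _ h]; first exact: cst_continuous.
    by apply: continuousD; [exact: cg | exact: cg'].
  by apply: cvgZr_tmp; exact: frame_coord_continuous.
have df_o : f \o shift x = cst (f x) + dfL +o_ 0 id.
  apply/eqaddoP => _/posnumP[eps].
  pose lip i := cid2 (linear_lipschitz (@frame_coord_continuous _ _ e i)).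
  pose K := 1 + \sum_i sval (lip i).
  pose L := 1 + \sum_i sval (lip i) * `|b i|.
  have lip_gt0 i : 0 < sval (lip i) by case: (lip i).
  have lipP i h : `|c i h| <= sval (lip i) * `|h| by case: (lip i) => /= k _.
  have K_gt0 : 0 < K by rewrite ltr_pwDl// sumr_ge0// => i _; exact/ltW/lip_gt0.
  have L_gt0 : 0 < L.
    by rewrite ltr_pwDl// sumr_ge0// => i _; rewrite mulr_ge0// ltW.
  have : \forall z \near x, forall i, derivable f z (b i) /\
     `|'D_(b i) f z - 'D_(b i) f x| <= eps%:num / K.
    apply: filter_forall => i.
    have [_ /(_ (b i))[dfi [/(_ x Ux) cdfi _]]] := Cf.
    have nU : \forall z \near x, U z by exact: open_nbhs_nbhs.
    have nD : \forall z \near x, `|'D_(b i) f z - 'D_(b i) f x| < eps%:num / K.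
      have /cvgrPdist_lt/(_ _ (divr_gt0 (gt0 eps) K_gt0)) nD := cdfi.
      by near=> z; rewrite distrC; near: z; exact: nD.
    near=> z; split; first by apply: dfi; near: z.
    by apply: ltW; near: z.
  move=> /nbhs_ballP[rho /= rho0 near_x].
  have hsmall : \forall h \near (0 : V), `|h| < rho / L.
    by apply: nbhs0_lt; rewrite divr_gt0.
  near=> h; have h_small : `|h| < rho / L by near: h.
  have dot_le : \sum_i `|c i h| * `|b i| < rho.
    apply: (@le_lt_trans _ _ (L * `|h|)); last by rewrite mulrC -ltr_pdivlMr.
    rewrite /L mulrDl mul1r -[leLHS]add0r lerD// mulr_suml ler_sum// => i _.
    by rewrite mulrAC ler_wpM2r.
  have := @C1_increment f x rho (eps%:num / K) (index_enum _) (fun i => c i h) _ dot_le.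
  have near_x' z : `|z - x| < rho -> forall i, derivable f z (b i) /\
      `|'D_(b i) f z - 'D_(b i) f x| <= eps%:num / K.
    by move=> zx; apply: near_x; rewrite -ball_normE/= distrC.
  move=> /(_ near_x'); rewrite -[X in _ `|f (x + X) - _ - _|](frame_sum e) => incr.
  have -> : (f \o +%R^~ x - (cst (f x) + df)) h =
      f (x + h) - f x - \sum_i c i h * 'D_(b i) f x.
    by rewrite -addrA -opprD [x + h]addrC.
  apply: le_trans incr _; rewrite -mulrA ler_wpM2l// mulrC ler_pdivrMr// mulrC.
  rewrite /K mulrDl mul1r -[leLHS]add0r lerD// mulr_suml.
  by apply: ler_sum => i _; exact: lipP.
by apply/diff_locallyP; rewrite (diff_unique df_cont df_o).
Unshelve. all: by end_near.
Qed.

Lemma derive_frame (f : V -> R^o) x v : differentiable f x ->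
  'D_v f x = \sum_i c i v * 'D_(b i) f x.
Proof.
move=> df; rewrite deriveE// {1}(frame_sum e v) linear_sum; apply: eq_bigr => i _.
by rewrite linearZ/= -deriveE.
Qed.

(** By induction on [k]: in coordinates the chain rule writes the derivative of
    the composite as a sum of products of functions of the class below. *)
Lemma is_Ck_comp (W : normedModType R) k (U : set W) (U' : set V) (g : W -> V) (f : V -> R^o) :
  open U -> open U' -> (forall x, U x -> U' (g x)) ->
  is_Ck k U g -> is_Ck k U' f -> is_Ck k U (f \o g).
Proof.
move=> oU oU' gU; elim: k f => [|k IHk] f Cg Cf.
  by split=> // x Ux; apply: continuous_comp; [exact: Cg.1|apply: Cf.1; exact: gU].
split=> [x Ux|v].
  by apply: continuous_comp; [exact: Cg.1|apply: Cf.1; exact: gU].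
have dgv x Ux := @is_Ck_derivable _ _ _ _ _ _ x v Cg Ux.
have Cf1 : is_Ck 1 U' f by apply: is_Ck_le Cf.
have dfg x Ux := C1_differentiable oU' Cf1 (gU x Ux).
have dcomp x Ux := is_derive_comp (dgv x Ux) (dfg x Ux).
split=> [x Ux|]; first by have [] := dcomp x Ux.
apply: (@is_Ck_ext _ _ _ _ _ (\sum_i ((c i \o 'D_v g) * ('D_(b i) f \o g)))) => //.
  by move=> x Ux; have [_ ->] := dcomp x Ux; rewrite derive_frame ?fct_sumE//; exact: dfg.
apply: is_Ck_sum => // i; apply: is_Ck_mul => //.
  by apply: is_Ck_linear => //; [exact: frame_coord_continuous | exact: is_Ck_derive].
by apply: IHk; [exact: is_Ck_pred | exact: is_Ck_derive].
Qed.

End FrechetDifferentiability.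

(** * Second derivatives *)

Section SecondDerivatives.
Variables (R : realType) (V : normedModType R).
Implicit Types (f : V -> R^o) (U : set V).

Lemma is_derive_translate f (k y v : V) : derivable f (y + k) v ->
  is_derive y v (fun y => f (y + k)) ('D_v f (y + k)).
Proof.
move=> df; have E : (fun h : R => h^-1 *: (((fun y => f (y + k)) \o shift y) (h *: v) - f (y + k)))
   = (fun h : R => h^-1 *: ((f \o shift (y + k)) (h *: v) - f (y + k))).
  by apply/funext => h /=; rewrite addrA.
by apply: DeriveDef; rewrite /derivable /derive E.
Qed.

(** The mean value theorem is applied twice: along [v] to the difference of two
    translates of [f], then along [w] to the derivative. *)
Lemma second_difference f (x v w : V) (rho h : R) :
  is_Ck 2 (ball x rho) f -> 0 <= h -> h * `|v| + h * `|w| < rho ->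
  exists2 z, ball x rho z &
    f (x + h *: v + h *: w) - f (x + h *: v) - (f (x + h *: w) - f x) =
      h * (h * 'D_w ('D_v f) z).
Proof.
move=> Cf h0 small.
have in_ball (s t : R) : 0 <= s <= 1 -> 0 <= t <= 1 ->
    ball x rho (x + (s * h) *: v + (t * h) *: w).
  move=> /andP[s0 s1] /andP[t0 t1]; rewrite -ball_normE/=.
  rewrite -addrA opprD addNKr normrN; apply: le_lt_trans small.
  apply: le_trans (ler_normD _ _) _; rewrite !normrZ ?normrM.
  rewrite (ger0_norm s0) (ger0_norm t0) (ger0_norm h0).
  by apply: lerD; rewrite ler_wpM2r// ler_piMl.
have I0 : 0 <= (0 : R) <= 1 by rewrite lexx ler01.
have I1 : 0 <= (1 : R) <= 1 by rewrite lexx ler01.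
have dv z : ball x rho z -> derivable f z v by move=> ?; exact: is_Ck_derivable Cf _.
have dwv z : ball x rho z -> derivable ('D_v f) z w.
  by move=> ?; exact: is_Ck_derivable (is_Ck_derive v Cf) _.
pose g y := f (y + h *: w) - f y.
have dg (s : R) : 0 <= s <= 1 -> is_derive (x + (s * h) *: v) v g
    ('D_v f (x + (s * h) *: v + h *: w) - 'D_v f (x + (s * h) *: v)).
  move=> s01; apply: is_deriveB.
    by apply: is_derive_translate; apply: dv; have := in_ball s 1 s01 I1; rewrite mul1r.
  by apply/derivableP/dv; have := in_ball s 0 s01 I0; rewrite mul0r scale0r addr0.
have [|s s01 gE] := @mean_value_line _ _ g x v h.
  by move=> s s01; have [] := dg s s01.
have s01' : 0 <= s <= 1 by case/andP: s01 => ? ?; rewrite !ltW.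
rewrite -/(g (x + h *: v)) -/(g x) gE; have [_ ->] := dg s s01'.
have [|t t01 ->] := @mean_value_line _ _ ('D_v f) (x + (s * h) *: v) w h.
  by move=> t t01; apply: dwv; exact: in_ball.
exists (x + (s * h) *: v + (t * h) *: w) => //; apply: in_ball => //.
by case/andP: t01 => ? ?; rewrite !ltW.
Qed.

(** The second difference is symmetric in [v] and [w]. Hence the two mixed
    derivatives take a common value at suitable points arbitrarily close to [x]. *)
Theorem schwarz f U x v w : open U -> is_Ck 2 U f -> U x ->
  'D_v ('D_w f) x = 'D_w ('D_v f) x.
Proof.
move=> oU Cf Ux; apply/eqP; rewrite -subr_eq0 -normr_le0; apply/ler_addgt0Pr => eps eps0.
have eps2 : 0 < eps / 2 by rewrite divr_gt0.
have cvw (a b : V) : \forall z \near x, `|'D_a ('D_b f) x - 'D_a ('D_b f) z| < eps / 2.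
  have /cvgrPdist_lt : {for x, continuous ('D_a ('D_b f))}.
    by have [/(_ x Ux)] := is_Ck_derive a (is_Ck_derive b Cf).
  exact.
have : \forall z \near x, U z /\ (`|'D_v ('D_w f) x - 'D_v ('D_w f) z| < eps / 2 /\
    `|'D_w ('D_v f) x - 'D_w ('D_v f) z| < eps / 2).
  by apply: filterI; [exact: open_nbhs_nbhs | apply: filterI; exact: cvw].
move=> /nbhs_ballP[rho /= rho0 near_x].
have Cf' : is_Ck 2 (ball x rho) f by apply: is_Ck_sub Cf => z /near_x[].
pose h := rho / (2 * (1 + `|v| + `|w|)).
have L0 : 0 < 1 + `|v| + `|w| by rewrite -addrA ltr_pwDl// addr_ge0.
have h0 : 0 < h by rewrite divr_gt0// mulr_gt0.
have small : h * `|v| + h * `|w| < rho.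
  rewrite -mulrDr /h mulrAC ltr_pdivrMr ?mulr_gt0// ltr_pM2l//.
  by have := normr_ge0 v; have := normr_ge0 w; lra.
have [z1 bz1 E1] := second_difference Cf' (ltW h0) small.
have small' : h * `|w| + h * `|v| < rho by rewrite addrC.
have [z2 bz2 E2] := second_difference Cf' (ltW h0) small'.
have E : 'D_w ('D_v f) z1 = 'D_v ('D_w f) z2.
  suff EE : h * (h * 'D_w ('D_v f) z1) = h * (h * 'D_v ('D_w f) z2).
    by move: EE => /(mulfI (lt0r_neq0 h0))/(mulfI (lt0r_neq0 h0)).
  apply: (etrans (esym E1)); apply: (etrans _ E2).
  have regroup (p q r t : R) : p - q - (r - t) = p - r - (q - t) by ring.
  by rewrite [x + h *: w + h *: v]addrAC; exact: regroup.
have [_ [_ n1]] := near_x _ bz1; have [_ [n2 _]] := near_x _ bz2.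
rewrite add0r; rewrite E in n1.
have -> : 'D_v ('D_w f) x - 'D_w ('D_v f) x =
  ('D_v ('D_w f) x - 'D_v ('D_w f) z2) - ('D_w ('D_v f) x - 'D_v ('D_w f) z2).
  by rewrite opprB addrA subrK.
apply: le_trans (ler_normB _ _) _; rewrite [leRHS](splitr eps).
by apply: lerD; apply: ltW; [exact: n2 | exact: n1].
Qed.

(** A derivative of the wrong sign at [x] would keep its sign nearby, and the
    mean value theorem would produce a value of [f] below the minimum. *)
Lemma second_derivative_test f U x v : open U -> is_Ck 2 U f -> U x ->
  (forall z, U z -> f x <= f z) -> 'D_v f x = 0 /\ 0 <= 'D_v ('D_v f) x.
Proof.
move=> oU Cf Ux fmin.
have nU : \forall z \near x, U z by exact: open_nbhs_nbhs.
have on_line (P : V -> Prop) : (\forall z \near x, P z) ->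
    exists2 h : R, 0 < h & forall t : R, `|t| <= h -> P (x + t *: v).
  move=> /nbhs_ballP[rho /= rho0 bP].
  have L0 : 0 < 1 + `|v| by rewrite ltr_pwDl.
  exists (rho / (2 * (1 + `|v|))); first by rewrite divr_gt0// mulr_gt0.
  move=> t th; apply: bP; rewrite -ball_normE/= opprD addNKr normrN normrZ.
  apply: (@le_lt_trans _ _ (rho / (2 * (1 + `|v|)) * `|v|)); first by rewrite ler_wpM2r.
  rewrite mulrAC ltr_pdivrMr ?mulr_gt0// ltr_pM2l//.
  by have := normr_ge0 v; lra.
have cv : {for x, continuous ('D_v f)} by have [/(_ x Ux)] := is_Ck_derive v Cf.
have cvv : {for x, continuous ('D_v ('D_v f))}.
  by have [/(_ x Ux)] := is_Ck_derive v (is_Ck_derive v Cf).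
have le_line (s t h : R) : 0 <= s <= 1 -> `|t| <= h -> `|s * t| <= h.
  move=> /andP[s0 s1]; apply: le_trans.
  by rewrite normrM (ger0_norm s0) ler_piMl.
have no_slope (t0 : R) : 0 < t0 * 'D_v f x -> False.
  move=> slope; have : \forall z \near x, U z /\ t0 * 'D_v f z > 0.
    apply: filterI => //.
    have : (fun z => t0 * 'D_v f z) @ x --> t0 * 'D_v f x by exact: cvgMl_tmp.
    by move/cvgr_gt; apply.
  move=> /on_line[h h0 hP].
  have t0_neq0 : t0 != 0 by apply: contraTneq slope => ->; rewrite mul0r ltxx.
  (* The step goes down the slope, whose sign is that of [t0]. *)
  pose t := - h * Num.sg t0.
  have th : `|t| <= h by rewrite normrM normrN normr_sg t0_neq0 mulr1 ger0_norm// ltW.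
  have [s s01|s s01 fE] := @mean_value_line _ _ f x v t.
    by apply: is_Ck_derivable Cf _; apply: (hP _ (le_line _ _ _ s01 th)).1.
  have s01' : 0 <= s <= 1 by case/andP: s01 => ? ?; rewrite !ltW.
  have [_ slope_s] := hP _ (le_line _ _ _ s01' th).
  have := fmin _ (hP _ th).1; rewrite -subr_ge0 fE leNgt => /negP; apply.
  have : 0 < `|t0| by rewrite normr_gt0.
  move: slope_s; rewrite {1}[t0]numEsg -mulrA => slope_s n0.
  rewrite /t -mulrA mulNr oppr_lt0 mulr_gt0//.
  by move: slope_s; rewrite mulrCA pmulr_rgt0.
have Dv0 : 'D_v f x = 0.
  apply/eqP; rewrite eq_le !leNgt; apply/andP; split; apply/negP => lt0.
    by apply: (no_slope 1); rewrite mul1r.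
  by apply: (no_slope (-1)); rewrite mulN1r oppr_gt0.
split=> //; rewrite leNgt; apply/negP => lt0.
have : \forall z \near x, U z /\ 'D_v ('D_v f) z < 0.
  by apply: filterI => //; move/cvgr_lt: cvv; apply.
move=> /on_line[h h0 hP].
have hh : `|h| <= h by rewrite gtr0_norm.
have [s s01|s s01 fE] := @mean_value_line _ _ f x v h.
  by apply: is_Ck_derivable Cf _; apply: (hP _ (le_line _ _ _ s01 hh)).1.
have s01' : 0 <= s <= 1 by case/andP: s01 => ? ?; rewrite !ltW.
have sh := le_line _ _ _ s01' hh.
have [a a01|a a01 dE] := @mean_value_line _ _ ('D_v f) x v (s * h).
  apply: is_Ck_derivable (is_Ck_derive v Cf) _.
  exact: (hP _ (le_line _ _ _ a01 sh)).1.
have a01' : 0 <= a <= 1 by case/andP: a01 => ? ?; rewrite !ltW.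
have [_ neg] := hP _ (le_line _ _ _ a01' sh).
have := fmin _ (hP _ hh).1; rewrite -subr_ge0 fE leNgt => /negP; apply.
rewrite Dv0 subr0 in dE; rewrite dE pmulr_rlt0// pmulr_rlt0//.
by case/andP: s01 => s0 _; rewrite mulr_gt0.
Qed.

End SecondDerivatives.

(** * Coordinates and smooth maps on subsets *)

Section Frames.
Variable R : realType.
Implicit Types V W : normedModType R.

Section CoordinatewiseSmoothness.
Variables (W : normedModType R) (e : frame W).

Lemma is_Ck_scalel V k (U : set V) (f : V -> R^o) (w : W) :
  open U -> is_Ck k U f -> is_Ck k U (fun x => f x *: w).
Proof.
move=> oU Cf; pose l (t : R^o) : W := t *: w.
have l_lin : linear l by move=> a u v; rewrite /l scalerDl scalerA.
pose lM := GRing.isLinear.Build _ _ _ _ l l_lin.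
pose lL : {linear R^o -> W} := HB.pack l lM.
apply: (@is_Ck_linear _ _ _ _ k U lL f) => // x.
exact: scalel_continuous.
Qed.

Lemma is_Ck_coordP V k (U : set V) (f : V -> W) : open U ->
  (forall i, is_Ck k U (@frame_coord _ _ e i \o f : V -> R^o)) -> is_Ck k U f.
Proof.
move=> oU Cf; rewrite (_ : f = \sum_(i : frame_index e) (fun x => @frame_coord _ _ e i (f x) *: frame_vec i)).
  by apply: is_Ck_sum => // i; apply: is_Ck_scalel => //; exact: Cf.
by apply/funext => x; rewrite fct_sumE -frame_sum.
Qed.

End CoordinatewiseSmoothness.

Lemma is_Ck_comp_frame V V' W (e : frame V) (e' : frame W) k (U : set V')
    (U' : set V) (g : V' -> V) (f : V -> W) :
  open U -> open U' -> (forall x, U x -> U' (g x)) ->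
  is_Ck k U g -> is_Ck k U' f -> is_Ck k U (f \o g).
Proof.
move=> oU oU' gU Cg Cf; apply: (is_Ck_coordP (e := e')) => // i.
apply: (is_Ck_comp e oU oU' gU Cg (f := @frame_coord _ _ e' i \o f)).
by apply: is_Ck_linear => //; exact: frame_coord_continuous.
Qed.

(** The map [F] is smooth only through local extensions off [A]; composing it
    with a map into [A] removes the dependence on the extension. *)
Lemma smooth_map_comp V V' W (e : frame V) (e' : frame W) (A : set V)
    (F : V -> W) (U : set V') (g : V' -> V) x :
  smooth_map A F -> open U -> smooth U g -> (forall y, U y -> A (g y)) -> U x ->
  exists U', [/\ open U', U' x, U' `<=` U & smooth U' (F \o g)].
Proof.
move=> /(_ (g x)) sF oU Cg gA Ux; have [W0 [F' [oW W0x CF' FF']]] := sF (gA _ Ux).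
pose U' := (U `&` g @^-1` W0)^°.
have U'U : U' `<=` U by move=> y /interior_subset[].
have U'W y : U' y -> W0 (g y) by move=> /interior_subset[].
have oU' : open U' by exact: open_interior.
exists U'; split=> //.
  apply: filterI; first exact: open_nbhs_nbhs.
  by have [/(_ x Ux) cg _] := Cg 0%N; apply: cg; exact: open_nbhs_nbhs.
move=> k; apply: (is_Ck_ext oU' (f := F' \o g)).
  by move=> y U'y; rewrite /= FF'//; [exact/gA/U'U | exact: U'W].
apply: (is_Ck_comp_frame e e' oU' oW U'W); last exact: CF'.
exact: is_Ck_sub U'U (Cg k).
Qed.

Definition rV_coord n (i : 'I_n) (v : 'rV[R]_n) : R^o := v 0 i.

Lemma rV_coord_linear n i : linear (@rV_coord n i).
Proof. by move=> a u v; rewrite /rV_coord !mxE. Qed.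

HB.instance Definition _ n i :=
  GRing.isLinear.Build R 'rV[R]_n R^o *:%R (@rV_coord n i) (@rV_coord_linear n i).

Lemma rV_coord_continuous n i : continuous (@rV_coord n i).
Proof. exact: coord_continuous. Qed.

Lemma rV_frame_sum n (v : 'rV[R]_n) :
  v = \sum_i rV_coord i v *: (delta_mx 0 i : 'rV[R]_n).
Proof. exact: row_sum_delta. Qed.

Definition rV_frame n : frame ('rV[R]_n : normedModType R) :=
  @Frame R 'rV[R]_n 'I_n (fun i => delta_mx 0 i) (fun i => @rV_coord n i)
    (@rV_coord_continuous n) (@rV_frame_sum n).

Variable n : nat.

Definition amb_coord (i : option 'I_n.+1) (p : ambient R n) : R^o :=
  if i is Some j then p.1 0 j else p.2.

Definition amb_vec (i : option 'I_n.+1) : ambient R n :=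
  if i is Some j then (delta_mx 0 j, 0) else (0, 1).

Lemma amb_coord_linear i : linear (amb_coord i).
Proof. by case: i => [j|] a u v; rewrite /amb_coord/= ?mxE. Qed.

HB.instance Definition _ i :=
  GRing.isLinear.Build R (ambient R n) R^o *:%R (amb_coord i) (@amb_coord_linear i).

Lemma amb_coord_continuous i : continuous (amb_coord i).
Proof.
case: i => [j|] p /=; last exact: cvg_snd.
apply: (@continuous_comp _ _ _ (fun p : ambient R n => p.1) (fun v => v 0 j)).
  exact: cvg_fst.
exact: coord_continuous.
Qed.

Lemma big_option (T : nmodType) (I : finType) (F : option I -> T) :
  \sum_i F i = F None + \sum_i F (Some i).
Proof.
rewrite (bigD1 None)//=; congr (_ + _); rewrite (reindex_omap Some id)/=.
  by apply: eq_bigl => i; rewrite eqxx.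
by case.
Qed.

Lemma amb_frame_sum (p : ambient R n) : p = \sum_i amb_coord i p *: amb_vec i.
Proof.
rewrite big_option; case: p => v t /=.
rewrite [X in _ = _ + X](_ : _ = (v, 0)).
  by congr pair; rewrite /= ?scaler0 ?add0r ?addr0// [t *: 1]mulr1.
rewrite [v in RHS](row_sum_delta v).
elim/big_ind2: _ => [//|x1 x2 y1 y2 -> ->|i _].
  by rewrite -[in RHS](addr0 (0 : R^o)).
by rewrite -[in RHS](scaler0 _ (v 0 i)).
Qed.

Definition amb_frame : frame (ambient R n) :=
  @Frame R (ambient R n) (option 'I_n.+1) amb_vec (fun i => amb_coord i)
    amb_coord_continuous amb_frame_sum.

End Frames.

(** * The quadratic forms of the two models *)

Section Forms.
Variables (R : realType) (s : space_form) (n : nat).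
Local Notation vec := (vec R n).
Local Notation ambient := (ambient R n).
Local Notation sgn := (sgn R s).
Local Notation qform := (@qform R s n).
Local Notation inner := (@inner R s n).
Implicit Types (x y z : vec) (p q : ambient).

Lemma sgn_sqr : sgn * sgn = 1.
Proof. by rewrite /Defs.sgn; case: s; rewrite ?mulrNN mulr1. Qed.

Definition qsign (i : 'I_n.+1) : R := if i == 0 then sgn else 1.

Lemma qformE x y : qform x y = \sum_i qsign i * (x 0 i * y 0 i).
Proof.
rewrite (bigD1 0)//= /qform /qsign eqxx; congr (_ + _).
by apply: eq_bigr => i /negPf ->; rewrite mul1r.
Qed.

Lemma qformC x y : qform x y = qform y x.
Proof. by rewrite !qformE; apply: eq_bigr => i _; rewrite (mulrC (x 0 i)). Qed.

Lemma qformPl a x y z : qform (a *: x + y) z = a * qform x z + qform y z.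
Proof.
rewrite !qformE mulr_sumr -big_split/=; apply: eq_bigr => i _.
by rewrite !mxE; ring.
Qed.

Lemma qform0l x : qform 0 x = 0.
Proof. by rewrite qformE big1// => i _; rewrite mxE mul0r mulr0. Qed.

Lemma qformDl x y z : qform (x + y) z = qform x z + qform y z.
Proof. by have := qformPl 1 x y z; rewrite scale1r mul1r. Qed.

Lemma qformZl a x z : qform (a *: x) z = a * qform x z.
Proof. by have := qformPl a x 0 z; rewrite addr0 qform0l addr0. Qed.

Lemma qformNl x z : qform (- x) z = - qform x z.
Proof. by rewrite -scaleN1r qformZl mulN1r. Qed.

Lemma qformBl x y z : qform (x - y) z = qform x z - qform y z.
Proof. by rewrite qformDl qformNl. Qed.

Lemma qform0r x : qform x 0 = 0. Proof. by rewrite qformC qform0l. Qed.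

Lemma qformDr x y z : qform z (x + y) = qform z x + qform z y.
Proof. by rewrite !(qformC z) qformDl. Qed.

Lemma qformZr a x z : qform z (a *: x) = a * qform z x.
Proof. by rewrite !(qformC z) qformZl. Qed.

Lemma qformNr x z : qform z (- x) = - qform z x.
Proof. by rewrite !(qformC z) qformNl. Qed.

Lemma qformBr x y z : qform z (x - y) = qform z x - qform z y.
Proof. by rewrite !(qformC z) qformBl. Qed.

Definition qformL := (qformDl, qformBl, qformNl, qformZl, qform0l).
Definition qformR := (qformDr, qformBr, qformNr, qformZr, qform0r).

Lemma innerE p q : inner p q = qform p.1 q.1 + p.2 * q.2.
Proof. by []. Qed.

Lemma innerC p q : inner p q = inner q p.
Proof. by rewrite /inner qformC mulrC. Qed.

Lemma innerDl p q w : inner (p + q) w = inner p w + inner q w.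
Proof. by rewrite /inner /= qformDl mulrDl; ring. Qed.

Lemma innerZl a p w : inner (a *: p) w = a * inner p w.
Proof. by rewrite /inner -[(a *: p).2]/(a * p.2) qformZl [in RHS]mulrDr mulrA. Qed.

Lemma inner0l w : inner 0 w = 0.
Proof. by have := innerZl 0 0 w; rewrite scale0r mul0r. Qed.

Lemma innerNl p w : inner (- p) w = - inner p w.
Proof. by rewrite -scaleN1r innerZl mulN1r. Qed.

Lemma inner_suml (I : Type) (r : seq I) (F : I -> ambient) w :
  inner (\sum_(i <- r) F i) w = \sum_(i <- r) inner (F i) w.
Proof. by elim/big_ind2: _ => [|p1 a1 p2 a2 <- <-|//]; rewrite ?inner0l ?innerDl. Qed.

Lemma innerZr a p w : inner w (a *: p) = a * inner w p.
Proof. by rewrite !(innerC w) innerZl. Qed.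

Lemma inner_sumr (I : Type) (r : seq I) (F : I -> ambient) w :
  inner w (\sum_(i <- r) F i) = \sum_(i <- r) inner w (F i).
Proof. by rewrite innerC inner_suml; apply: eq_bigr => i _; rewrite innerC. Qed.

Lemma inner_horizontal p x : inner p (x, 0) = qform p.1 x.
Proof. by rewrite /inner /= mulr0 addr0. Qed.

(** All the Cauchy-Schwarz inequalities used here are instances of this
    discriminant condition. *)
Lemma discriminant_le0 (a b c : R) :
  (forall t u : R, 0 <= t ^+ 2 * a + 2 * t * u * b + u ^+ 2 * c) -> b ^+ 2 <= a * c.
Proof.
move=> pos; have := pos c (- b); have := pos 0 1; have := pos 1 0.
rewrite !(expr0n, expr1n, mul0r, mul1r, mulr0, addr0, add0r) => a0 c0 h.
have [c_eq0|c_neq0] := eqVneq c 0.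
  have [->|b_neq0] := eqVneq b 0; first by rewrite expr0n mulr_ge0.
  have := pos 1 (- (a + 1) / b); rewrite c_eq0 !mulr0 addr0 mulr1 expr1n mul1r.
  by rewrite -mulrA divfK//; lra.
have {}c0 : 0 < c by rewrite lt_def c_neq0.
rewrite -subr_ge0 -(pmulr_rge0 _ c0).
by apply: le_trans h _; rewrite le_eqVlt; apply/orP; left; apply/eqP; ring.
Qed.

(** In the hyperbolic case the form is Lorentzian and [o] is timelike.
    Orthogonality says that the product of the zeroth coordinates of [v] and [o]
    is the Euclidean product of the others; by Cauchy-Schwarz and [o_0^2 = 1 +
    |o'|^2], the zeroth coordinate of [v] is then dominated by the others. *)
Lemma quadric_normal_pos (o v : vec) : quadric s o -> qform v o = 0 ->
  0 <= qform v v /\ (qform v v = 0 -> v = 0).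
Proof.
move=> [oo o0] vo; rewrite -/(qform o o) in oo.
pose S (x y : vec) := \sum_(i < n.+1 | i != 0) x 0 i * y 0 i.
have S0 x : 0 <= S x x by apply: sumr_ge0 => i _; rewrite -expr2 sqr_ge0.
have S_eq0 x : S x x = 0 -> x 0 0 = 0 -> x = 0.
  move=> /eqP; rewrite psumr_eq0 => [/allP xi0 x0|i _]; last by rewrite -expr2 sqr_ge0.
  apply/rowP => i; rewrite [RHS]mxE; have [->//|i0] := eqVneq i 0.
  by have := xi0 i (mem_index_enum _); rewrite i0 /= -expr2 sqrf_eq0 => /eqP.
case: s oo o0 vo => [oo /(_ erefl) o0 vo|oo _ vo].
  have CS : S v o ^+ 2 <= S v v * S o o.
    apply: discriminant_le0 => t u.
    have -> : t ^+ 2 * S v v + 2 * t * u * S v o + u ^+ 2 * S o o =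
        S (t *: v + u *: o) (t *: v + u *: o).
      rewrite /S !mulr_sumr -!big_split/=; apply: eq_bigr => i _.
      by rewrite !mxE; ring.
    exact: S0.
  move: oo vo; rewrite /Defs.qform /Defs.sgn -!/(S _ _) => oo vo.
  have Sv := S0 v; have So := S0 o.
  have h : v 0 0 ^+ 2 * (1 + S o o) <= S v v * S o o.
    have -> : v 0 0 ^+ 2 * (1 + S o o) = S v o ^+ 2; last exact: CS.
    have -> : S v o = v 0 0 * o 0 0 by lra.
    rewrite exprMn; congr (_ * _); lra.
  have v00 := sqr_ge0 (v 0 0); split; first by nra.
  move=> vv; have vv' : S v v = v 0 0 ^+ 2 by lra.
  have v0 : v 0 0 ^+ 2 = 0 by nra.
  by apply: S_eq0; [rewrite vv' | apply/eqP; rewrite -sqrf_eq0 v0].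
move: oo; rewrite /Defs.qform /Defs.sgn -!/(S _ _) !mul1r => oo; have Sv := S0 v.
have v00 := sqr_ge0 (v 0 0); split; first by nra.
move=> vv; have v0 : v 0 0 ^+ 2 = 0 by nra.
by apply: S_eq0; [nra | apply/eqP; rewrite -sqrf_eq0 v0].
Qed.

Lemma quadric_normal_CS (o v w : vec) : quadric s o ->
  qform v o = 0 -> qform w o = 0 -> qform v w ^+ 2 <= qform v v * qform w w.
Proof.
move=> qo vo wo; apply: discriminant_le0 => t u.
have tu0 : qform (t *: v + u *: w) o = 0 by rewrite !qformL vo wo !mulr0 addr0.
have [+ _] := quadric_normal_pos qo tu0; rewrite !(qformL, qformR) => h.
by apply: le_trans h _; rewrite (qformC w v) le_eqVlt; apply/orP; left; apply/eqP; ring.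
Qed.

(** Let [B] be the square matrix of coordinates of the family and [J] the
    diagonal matrix of the form. Orthonormality gives a right inverse of [B] in
    terms of [J], the transpose of [B] and the signs; it is also a left inverse,
    and this is the expansion. *)
Lemma orthonormal_expansion (b : 'I_n.+2 -> ambient) (eps : 'I_n.+2 -> R) (w : ambient) :
  (forall i, eps i * eps i = 1) ->
  (forall i j, inner (b i) (b j) = eps i *+ (i == j)) ->
  w = \sum_i (eps i * inner w (b i)) *: b i.
Proof.
move=> eps2 ortho.
(* Index 0 is the vertical coordinate, the others are those of the slice. *)
pose coord (p : ambient) (j : 'I_n.+2) : R :=
  if unlift ord0 j is Some k then p.1 0 k else p.2.
pose J (j : 'I_n.+2) : R := if unlift ord0 j is Some k then qsign k else 1.
have inner_coord p q : inner p q = \sum_j J j * (coord p j * coord q j).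
  rewrite big_ord_recl /J /coord unlift_none mul1r /inner qformE addrC; congr (_ + _).
  by apply: eq_bigr => i _; rewrite liftK.
have coord_inj p q : (forall j, coord p j = coord q j) -> p = q.
  case: p q => [x t] [y u] cpq; have := cpq ord0; rewrite /coord unlift_none/= => ->.
  congr pair; apply/rowP => i; have := cpq (lift ord0 i).
  by rewrite /coord liftK.
pose B := \matrix_(i, j) coord (b i) j.
pose JD := diag_mx (\row_j J j); pose D := diag_mx (\row_i eps i).
have BJB : B *m JD *m B^T = D.
  apply/matrixP => i j; rewrite mul_mx_diag !mxE.
  rewrite -ortho inner_coord; apply: eq_bigr => k _; rewrite !mxE; ring.
have inv : B *m (JD *m B^T *m D) = 1%:M.
  rewrite !mulmxA BJB mulmx_diag -diag_const_mx; congr diag_mx.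
  by apply/rowP => i; rewrite !mxE eps2.
have := mulmx1C inv; move/(congr1 (mulmx (\row_j coord w j))); rewrite mulmx1 => wE.
have coord_sum (F : 'I_n.+2 -> ambient) j :
    coord (\sum_i F i) j = \sum_i coord (F i) j.
  elim/big_ind2: _ => [|p1 a1 p2 a2 <- <-|//]; rewrite /coord; case: unlift => //= k; by rewrite mxE.
apply: coord_inj => j; rewrite coord_sum.
have -> : coord w j = (\row_j coord w j) 0 j by rewrite mxE.
rewrite -wE.
rewrite !mulmxA mxE; apply: eq_bigr => i _; rewrite mul_mx_diag !mxE.
have -> : coord ((eps i * inner w (b i)) *: b i) j = eps i * inner w (b i) * coord (b i) j.
  by rewrite /coord; case: unlift => //= k; rewrite mxE.
congr (_ * _); rewrite mulrC; congr (_ * _).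
rewrite inner_coord; apply: eq_bigr => k _; rewrite mul_mx_diag !mxE; ring.
Qed.

Lemma is_derive_qform (V : normedModType R) (f g : V -> ambient) a v df dg :
  is_derive a v f df -> is_derive a v g dg ->
  is_derive a v (fun t => qform (f t).1 (g t).1 : R^o)
    (qform df.1 (g a).1 + qform (f a).1 dg.1).
Proof.
move=> Df Dg.
have -> : (fun t => qform (f t).1 (g t).1 : R^o) =
    \sum_i (qsign i \*: ((amb_coord (Some i) \o f) * (amb_coord (Some i) \o g)) : V -> R^o).
  by apply/funext => t; rewrite fct_sumE qformE.
have Dfi i := is_derive_linear (@amb_coord_continuous R n (Some i)) Df.
have Dgi i := is_derive_linear (@amb_coord_continuous R n (Some i)) Dg.
have H := is_derive_sum (fun i => is_deriveZ (qsign i) (is_deriveM (Dfi i) (Dgi i))).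
apply: is_derive_eq H _.
rewrite !qformE -big_split; apply: eq_bigr => i _ /=.
by rewrite /GRing.scale/=; ring.
Qed.

Lemma is_derive_inner (V : normedModType R) (f g : V -> ambient) a v df dg :
  is_derive a v f df -> is_derive a v g dg ->
  is_derive a v (fun t => inner (f t) (g t) : R^o)
    (inner df (g a) + inner (f a) dg).
Proof.
move=> Df Dg.
have Df2 := is_derive_linear (@amb_coord_continuous R n None) Df.
have Dg2 := is_derive_linear (@amb_coord_continuous R n None) Dg.
have H := is_deriveD (is_derive_qform Df Dg) (is_deriveM Df2 Dg2).
apply: is_derive_eq H _; rewrite /inner /= /GRing.scale/=; ring.
Qed.

End Forms.

(** * Calculus for vector-valued maps *)

Section VectorValuedCalculus.
Variable R : realType.
Implicit Types V W : normedModType R.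

Lemma frame_inj W (e : frame W) (u w : W) :
  (forall i, @frame_coord _ _ e i u = @frame_coord _ _ e i w) -> u = w.
Proof.
by move=> uw; rewrite (frame_sum e u) (frame_sum e w); apply: eq_bigr => i _; rewrite uw.
Qed.

Lemma is_derive_coord V W (e : frame W) (f : V -> W) x v df :
  (forall i, is_derive x v (@frame_coord _ _ e i \o f : V -> R^o) (@frame_coord _ _ e i df)) ->
  is_derive x v f df.
Proof.
move=> Df; rewrite (frame_sum e df).
rewrite (_ : f = \sum_(i : frame_index e) (fun x => @frame_coord _ _ e i (f x) *: frame_vec i)); last first.
  by apply/funext => y; rewrite fct_sumE -frame_sum.
elim/big_ind2: _ => [|f1 d1 f2 d2 D1 D2|i _]; first exact: is_derive_cst.
  exact: is_deriveD.
pose l (t : R^o) : W := t *: @frame_vec _ _ e i.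
have l_lin : linear l by move=> a u w; rewrite /l scalerDl scalerA.
pose lM := GRing.isLinear.Build _ _ _ _ l l_lin.
pose lL : {linear R^o -> W} := HB.pack l lM.
by apply: (@is_derive_linear _ _ _ _ lL) (Df i) => t; exact: scalel_continuous.
Qed.

Lemma is_derive_chain V V' W (e : frame V) (e' : frame W) (f : V -> W)
    (U : set V) (c : V' -> V) x v dc :
  open U -> is_Ck 1 U f -> U (c x) -> is_derive x v c dc ->
  is_derive x v (f \o c) ('D_dc f (c x)).
Proof.
move=> oU Cf Ucx [dcx <-]; apply: (is_derive_coord (e := e')) => i.
have Cfi : is_Ck 1 U (@frame_coord _ _ e' i \o f).
  by apply: is_Ck_linear => //; exact: frame_coord_continuous.
have dfi := C1_differentiable e oU Cfi Ucx.
have [_ <-] := is_derive_linear (@frame_coord_continuous _ _ e' i)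
  (derivableP (is_Ck_derivable (v := 'D_v c x) Cf Ucx)).
exact: (is_derive_comp dcx dfi).
Qed.

Lemma derive_frame_vec V W (e : frame V) (e' : frame W) (f : V -> W) U x v :
  open U -> is_Ck 1 U f -> U x ->
  'D_v f x = \sum_i @frame_coord _ _ e i v *: 'D_(frame_vec i) f x.
Proof.
move=> oU Cf Ux; apply: (frame_inj (e := e')) => j; rewrite linear_sum.
have coordD w : @frame_coord _ _ e' j ('D_w f x) = 'D_w (@frame_coord _ _ e' j \o f) x.
  by have [_ ->] := is_derive_linear (@frame_coord_continuous _ _ e' j)
    (derivableP (is_Ck_derivable (v := w) Cf Ux)).
have Cfj : is_Ck 1 U (@frame_coord _ _ e' j \o f).
  by apply: is_Ck_linear => //; exact: frame_coord_continuous.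
rewrite coordD (derive_frame e); last exact: (C1_differentiable e oU Cfj Ux).
by apply: eq_bigr => i _; rewrite linearZ/= -coordD.
Qed.

Lemma schwarz_vec V W (e' : frame W) (f : V -> W) U x v w :
  open U -> is_Ck 2 U f -> U x -> 'D_v ('D_w f) x = 'D_w ('D_v f) x.
Proof.
move=> oU Cf Ux; apply: (frame_inj (e := e')) => j.
have Cfj : is_Ck 2 U (@frame_coord _ _ e' j \o f).
  by apply: is_Ck_linear => //; exact: frame_coord_continuous.
have E (a b : V) : @frame_coord _ _ e' j ('D_a ('D_b f) x) =
    'D_a ('D_b (@frame_coord _ _ e' j \o f)) x.
  have [_ <-] := is_derive_linear (@frame_coord_continuous _ _ e' j)
    (derivableP (is_Ck_derivable (v := a) (is_Ck_derive b Cf) Ux)).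
  apply: near_eq_derive; apply: (near_eq_open oU Ux) => y Uy /=.
  by have [_ ->] := is_derive_linear (@frame_coord_continuous _ _ e' j)
    (derivableP (is_Ck_derivable (v := b) Cf Uy)).
apply: (etrans (E v w)); apply: (etrans _ (esym (E w v))).
exact: (schwarz _ _ oU Cfj Ux).
Qed.

Lemma second_derive_frame V (e : frame V) (f : V -> R^o) U x :
  open U -> is_Ck 2 U f -> U x -> forall v,
  'D_v ('D_v f) x = \sum_i \sum_j
     @frame_coord _ _ e i v * @frame_coord _ _ e j v * 'D_(frame_vec i) ('D_(frame_vec j) f) x.
Proof.
move=> oU Cf Ux v.
have C1 : is_Ck 1 U f by exact: is_Ck_pred.
have E : 'D_v ('D_v f) x = 'D_v (\sum_j (@frame_coord _ _ e j v \*: 'D_(frame_vec j) f)) x.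
  apply: near_eq_derive; apply: (near_eq_open oU Ux) => y Uy /=.
  by rewrite fct_sumE (derive_frame e)//; exact: (C1_differentiable e oU C1 Uy).
rewrite E (derive_frame e); last first.
  have Cj j : is_Ck 1 U (@frame_coord _ _ e j v \*: 'D_(frame_vec j) f).
    have := is_Ck_mul oU (is_Ck_cst 1 U (@frame_coord _ _ e j v)) (is_Ck_derive (frame_vec j) Cf).
    by apply: is_Ck_ext.
  exact: (C1_differentiable e oU (is_Ck_sum _ oU Cj) Ux).
apply: eq_bigr => i _.
have -> : 'D_(frame_vec i) (\sum_j (@frame_coord _ _ e j v \*: 'D_(frame_vec j) f)) x =
    \sum_j @frame_coord _ _ e j v * 'D_(frame_vec i) ('D_(frame_vec j) f) x.
  have [_ //] : is_derive x (frame_vec i) (\sum_j (@frame_coord _ _ e j v \*: 'D_(frame_vec j) f))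
      (\sum_j (@frame_coord _ _ e j v * 'D_(frame_vec i) ('D_(frame_vec j) f) x)).
  elim/big_ind2: _ => [|f1 d1 f2 d2 D1 D2|j _]; first exact: is_derive_cst.
    exact: is_deriveD.
  by apply: is_deriveZ; apply/derivableP/(is_Ck_derivable (is_Ck_derive _ Cf) Ux).
by rewrite mulr_sumr; apply: eq_bigr => j _; rewrite mulrA.
Qed.

Lemma real_frame_sum (t : R^o) : t = \sum_(i : unit) idfun t *: (1 : R^o).
Proof. by rewrite big_const card_unit /= addr0 [_ *: _]mulr1. Qed.

Definition real_frame : frame (R^o : normedModType R) :=
  @Frame R R^o unit (fun _ => 1) (fun _ => idfun) (fun _ t => cvg_id) real_frame_sum.

End VectorValuedCalculus.

(** * Local parametrizations of a hypersurface *)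

Section Hypersurface.
Variables (R : realType) (s : space_form) (n : nat).
Local Notation ambient := (ambient R n).
Local Notation sgn := (sgn R s).
Local Notation qform := (@qform R s n).
Local Notation inner := (@inner R s n).
Variables (M : set ambient) (N : ambient -> ambient).
Hypotheses (hM : embedded_hypersurface s M) (hN : unit_normal s M N).

Lemma quadric_neq0 (p : ambient) : quadric s p.1 -> p.1 != 0.
Proof.
move=> [pp _]; apply/eqP => p0; move: pp; rewrite p0 qform0l => /eqP.
by rewrite eq_sym /Defs.sgn; case: s; rewrite ?oppr_eq0 oner_eq0.
Qed.

Lemma sgn_neq0 : sgn != 0.
Proof. by rewrite /Defs.sgn; case: s; rewrite ?oppr_eq0 oner_eq0. Qed.

Lemma normal_horizontal p : M p -> qform (N p).1 p.1 = 0.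
Proof.
move=> Mp; have [_ /(_ p Mp) + _ _] := hN; have qp := hM.1 p Mp.
move=> /(congr1 fst)/= /eqP; rewrite -subr_eq0 addrC addrA addNr sub0r oppr_eq0.
rewrite scaler_eq0 (negPf (quadric_neq0 qp)) orbF mulf_eq0 (negPf sgn_neq0)/=.
by move/eqP.
Qed.

Section LocalParametrization.
Variables (U : set 'rV[R]_n) (phi : 'rV[R]_n -> ambient).
Hypothesis hphi : local_param M U phi.

Lemma param_open : open U. Proof. by case: hphi. Qed.
Lemma param_Ck k : is_Ck k U phi. Proof. by case: hphi => _ + _ _; exact. Qed.

Lemma param_in y : U y -> M (phi y).
Proof.
move=> Uy; have [_ _ [W [_ phiU]] _] := hphi.
have : (phi @` U) (phi y) by exists y.
by rewrite phiU => -[].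
Qed.

Lemma smooth_on_param (W : normedModType R) (e : frame W) (F : ambient -> W) x :
  smooth_map M F -> U x ->
  exists U', [/\ open U', U' x, U' `<=` U & smooth U' (F \o phi)].
Proof.
move=> sF Ux; apply: (smooth_map_comp (amb_frame R n) e sF param_open _ _ Ux).
  exact: param_Ck.
exact: param_in.
Qed.

Lemma param_derivable x v : U x -> derivable phi x v.
Proof. exact: is_Ck_derivable (param_Ck 1). Qed.

Lemma param_derive_sum x (v : 'rV[R]_n) : U x -> 'D_v phi x = \sum_i v 0 i *: partial i phi x.
Proof.
move=> Ux; exact: (derive_frame_vec (rV_frame R n) (amb_frame R n) v param_open (param_Ck 1) Ux).
Qed.

(** The inverse of the parametrization extends smoothly to the ambient space. On
    the open set that cuts the image out of [M], every point of [M] belongs to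
    the image. *)
Lemma param_chart x : U x -> exists (W : set ambient) (psi : ambient -> 'rV[R]_n),
  [/\ open W, W (phi x), smooth W psi &
    forall p, W p -> M p -> U (psi p) /\ phi (psi p) = p].
Proof.
move=> Ux; have [_ _ [W [oW phiU]] [psi [spsi psiK]]] := hphi.
have [|W1 [psi1 [oW1 W1x Cpsi1 psi1E]]] := spsi (phi x); first by exists x.
exists (W `&` W1), psi1; split.
- exact: openI.
- split=> //; have : (phi @` U) (phi x) by exists x.
  by rewrite phiU => -[].
- by move=> k; apply: is_Ck_sub (Cpsi1 k) => z [].
move=> p [Wp W1p] Mp; have : (phi @` U) p by rewrite phiU.
by move=> [y Uy yp]; rewrite psi1E// -yp ?psiK//; exists y.
Qed.

(** The smooth left inverse of [phi] gives a left inverse of its differential. *)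
Lemma param_immersion x (v : 'rV[R]_n) : U x -> 'D_v phi x = 0 -> v = 0.
Proof.
move=> Ux Dv0; have [W [psi [oW Wx Cpsi psiK]]] := param_chart Ux.
have [_ _ _ [psi0 [_ psi0K]]] := hphi.
have phi_inj y y' : U y -> U y' -> phi y = phi y' -> y = y'.
  by move=> Uy Uy' E; rewrite -(psi0K y Uy) E psi0K.
have nid : \near x, (psi \o phi) x = id x.
  have nW : \forall y \near x, W (phi y).
    by have [/(_ x Ux) cphi _] := param_Ck 0; apply: cphi; exact: open_nbhs_nbhs.
  have nU : \forall y \near x, U y by apply: open_nbhs_nbhs; split=> //; exact: param_open.
  near=> y; have Wy : W (phi y) by near: y.
  have Uy : U y by near: y.
  by have [Upy pE] := psiK _ Wy (param_in Uy); exact: phi_inj.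
have [_] := is_derive_chain (amb_frame R n) (rV_frame R n) oW (Cpsi 1%N) Wx
  (derivableP (param_derivable (v := v) Ux)).
by rewrite (near_eq_derive v nid) derive_id Dv0 derive0.
Unshelve. all: by end_near.
Qed.

Lemma normal_orthogonal x v : U x -> inner (N (phi x)) ('D_v phi x) = 0.
Proof.
move=> Ux; have [_ _ _ /(_ U phi hphi x Ux) orth] := hN.
by rewrite param_derive_sum// inner_sumr big1// => i _; rewrite innerZr orth mulr0.
Qed.

Lemma tangent_horizontal x v : U x -> qform ('D_v phi x).1 (phi x).1 = 0.
Proof.
move=> Ux; have Dphi := derivableP (param_derivable (v := v) Ux).
have [_] := is_derive_qform s Dphi Dphi.
rewrite (near_eq_derive (g := cst (sgn : R^o))).
  rewrite derive_cst (qformC s (phi x).1) => /esym/eqP.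
  by rewrite -mulr2n mulrn_eq0/= => /eqP.
by apply: (near_eq_open param_open Ux) => y Uy; case: (hM.1 _ (param_in Uy)).
Qed.

End LocalParametrization.

(** Read in a chart, the curve has a velocity which is a combination of the
    coordinate fields, to which the normal is orthogonal by definition.
    Rotational symmetry provides curves in [M], not coordinate fields. *)
Lemma normal_curve (c : R^o -> ambient) (dc : ambient) :
  is_derive (0 : R^o) 1 c dc -> (\forall t \near (0 : R^o), M (c t)) ->
  inner (N (c 0)) dc = 0.
Proof.
move=> Dc Mc; have Mc0 : M (c 0) := nbhs_singleton Mc.
have [U [phi [x [hphi Ux phix]]]] := hM.2 _ Mc0.
have [W [psi [oW Wx Cpsi psiK]]] := param_chart hphi Ux.
rewrite phix in Wx.
pose y := psi \o c.
have Dy := is_derive_chain (amb_frame R n) (rV_frame R n) oW (Cpsi 1%N) Wx Dc.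
have yU : U (y 0) by have [] := psiK _ Wx Mc0.
have phiy0 : phi (y 0) = c 0 by have [] := psiK _ Wx Mc0.
have nphiy : \forall t \near (0 : R^o), (phi \o y) t = c t.
  have nW : \forall t \near (0 : R^o), W (c t).
    have [dc1 _] := Dc; have cc : {for (0 : R^o), continuous c}.
      by apply: differentiable_continuous; exact/derivable1_diffP.
    by apply: cc; exact: open_nbhs_nbhs.
  near=> t; have Wt : W (c t) by near: t.
  by have [|_ //] := psiK _ Wt; near: t.
have [_] := is_derive_chain (rV_frame R n) (amb_frame R n) (param_open hphi)
  (param_Ck hphi 1) yU Dy.
rewrite (near_eq_derive _ nphiy); have [_ ->] := Dc => ->.
by rewrite -phiy0; exact: (normal_orthogonal hphi _ yU).
Unshelve. all: by end_near.
Qed.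

End Hypersurface.

(** * Curvature of the ambient space *)

Section AmbientCurvature.
Variables (R : realType) (s : space_form) (n : nat).
Local Notation ambient := (ambient R n).
Local Notation sgn := (sgn R s).
Local Notation qform := (@qform R s n).
Implicit Types (p q X Y Z : ambient).

Lemma is_derive_scale (V W : normedModType R) (e : frame W) (f : V -> R^o) (g : V -> W)
    x v (df : R) dg :
  is_derive x v f df -> is_derive x v g dg ->
  is_derive x v (fun t => f t *: g t) (f x *: dg + df *: g x).
Proof.
move=> Df Dg; apply: (is_derive_coord (e := e)) => i.
have Dgi := is_derive_linear (@frame_coord_continuous _ _ e i) Dg.
have := is_deriveM Df Dgi.
have -> : f * (@frame_coord _ _ e i \o g) = @frame_coord _ _ e i \o (fun t => f t *: g t).
  by apply/funext => t /=; rewrite linearZ.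
move=> D; apply: is_derive_eq D _.
by rewrite linearD !linearZ /= /GRing.scale/= (mulrC df).
Qed.

Definition horiz p : ambient := (p.1, 0).

Lemma horiz_linear : linear horiz.
Proof. by move=> a p q; rewrite /horiz; congr pair; rewrite /= scaler0 addr0. Qed.

HB.instance Definition _ :=
  GRing.isLinear.Build R ambient ambient *:%R horiz horiz_linear.

Lemma horiz_continuous : continuous horiz.
Proof.
move=> p; apply/cvgrPdist_lt => e e0.
have np : \forall q \near p, `|p - q| < e.
  by have /cvgrPdist_lt := @cvg_id _ (nbhs p); apply.
near=> q; apply: (@le_lt_trans _ _ `|p - q|); last by near: q.
rewrite -linearB [leRHS]prod_normE [leLHS]prod_normE /=.
by rewrite ge_max le_max lexx/= normr0 le_max normr_ge0.
Unshelve. all: by end_near.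
Qed.

Lemma tprojE p v : tproj s p v = v - (sgn * qform v.1 p.1) *: horiz p.
Proof. by case: v => v t; rewrite /tproj /horiz; congr pair; rewrite /= scaler0 subr0. Qed.

Lemma tproj_id p v : qform v.1 p.1 = 0 -> tproj s p v = v.
Proof. by move=> vp; rewrite tprojE vp mulr0 scale0r subr0. Qed.

Lemma is_derive_tproj (f g : ambient -> ambient) p v df dg :
  is_derive p v f df -> is_derive p v g dg ->
  is_derive p v (fun q => tproj s (f q) (g q))
    (dg - ((sgn * qform (g p).1 (f p).1) *: horiz df +
           (sgn * (qform dg.1 (f p).1 + qform (g p).1 df.1)) *: horiz (f p))).
Proof.
move=> Df Dg.
have Dq := is_deriveZ sgn (is_derive_qform s Dg Df).
have Dh := is_derive_linear horiz_continuous Df.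
have D := is_deriveB Dg (is_derive_scale (amb_frame R n) Dq Dh).
have -> : (fun q => tproj s (f q) (g q)) = g - (fun t : ambient => (sgn \*: (fun t => qform (g t).1 (f t).1 : R^o)) t *: (horiz \o f) t).
  by apply/funext => q; rewrite tprojE.
exact: D.
Qed.

Lemma is_derive_tproj_field X p v :
  is_derive p v (fun q => tproj s q X)
    (- ((sgn * qform X.1 p.1) *: horiz v + (sgn * qform X.1 v.1) *: horiz p)).
Proof.
have := is_derive_tproj (is_derive_id p v) (is_derive_cst X p v).
by rewrite /= qform0l !add0r.
Qed.

(** The inner covariant derivative has to be known at all points near [p],
    including those off the quadric. After the second differentiation, all terms
    with a factor that vanishes at [p] by tangency disappear. *)
Lemma cov_cov_tproj p X Y Z : quadric s p.1 ->
  qform X.1 p.1 = 0 -> qform Y.1 p.1 = 0 -> qform Z.1 p.1 = 0 ->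
  cov s (fun q => tproj s q X)
    (cov s (fun q => tproj s q Y) (fun q => tproj s q Z)) p =
  - (sgn * qform Z.1 X.1) *: horiz Y.
Proof.
move=> [pp _] Xp Yp Zp; rewrite -/(qform p.1 p.1) in pp.
have ss := sgn_sqr R s.
have -> : cov s (fun q => tproj s q Y) (fun q => tproj s q Z) =
    (fun q => tproj s q (- ((sgn * qform Z.1 q.1) *: horiz (tproj s q Y) +
       (sgn * qform Z.1 (tproj s q Y).1) *: horiz q))).
  by apply/funext => q; rewrite /cov; have [_ ->] := is_derive_tproj_field Z q (tproj s q Y).
rewrite /cov (tproj_id Xp).
have Dw := is_derive_tproj_field Y p X; rewrite Yp mulr0 scale0r add0r in Dw.
have Did := is_derive_id p X.
have Dh := is_derive_linear horiz_continuous Did.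
have Dhw := is_derive_linear horiz_continuous Dw.
have DZ := is_deriveZ sgn (is_derive_qform s (is_derive_cst Z p X) Did).
have DZw := is_deriveZ sgn (is_derive_qform s (is_derive_cst Z p X) Dw).
have fr := amb_frame R n.
have DV := is_deriveN (is_deriveD (is_derive_scale fr DZ Dhw) (is_derive_scale fr DZw Dh)).
have [_ ->] := is_derive_tproj Did DV.
rewrite /= (tproj_id Yp) Zp.
rewrite !(qformL, qformR) Xp Yp Zp (qformC s p.1 X.1) Xp pp.
have scaleRE (a b : R) : a *: (b : R^o) = a * b by [].
rewrite !(scaleRE, mulr0, mul0r, subr0, sub0r, oppr0, addr0, add0r, scale0r).
rewrite mulrN (mulrC _ sgn) mulrA ss mul1r scaleNr opprK.

rewrite opprD -addrA addNr addr0 -scaleNr tproj_id//.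
by rewrite [_.1]/= qformZl Yp mulr0.
Qed.

(** This is the curvature tensor of a space form of curvature [sgn], extended by
    zero in the vertical direction. *)
Lemma curvatureE p X Y Z : quadric s p.1 ->
  qform X.1 p.1 = 0 -> qform Y.1 p.1 = 0 -> qform Z.1 p.1 = 0 ->
  curvature s p X Y Z =
  sgn *: (qform Z.1 Y.1 *: horiz X - qform Z.1 X.1 *: horiz Y).
Proof.
move=> qp Xp Yp Zp; rewrite /curvature !cov_cov_tproj// /cov.
have -> : lie (fun q => tproj s q X) (fun q => tproj s q Y) p = 0.
  rewrite /lie.
  have [_ ->] := is_derive_tproj_field Y p (tproj s p X).
  have [_ ->] := is_derive_tproj_field X p (tproj s p Y).
  by rewrite Xp Yp !mulr0 !scale0r !add0r !tproj_id// (qformC s X.1) subrr.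
rewrite derive0 tproj_id ?qform0l// subr0 scalerBr !scalerA.
by rewrite !scaleNr opprK addrC.
Qed.

End AmbientCurvature.

(** * Compactness *)

Section Compactness.
Variable R : realType.

Lemma smooth_map_continuous (V W : normedModType R) (A : set V) (f : V -> W) :
  smooth_map A f -> {within A, continuous f}.
Proof.
move=> sf; apply/subspace_continuousP => x Ax.
have [U [F [oU Ux CF FE]]] := sf x Ax.
have [/(_ x Ux) cF _] := CF 0%N.
suff : f @ within A (nbhs x) --> f x by [].
rewrite -(FE x Ax Ux).
have FF : F @ within A (nbhs x) --> F x by apply: cvg_trans cF; apply: cvg_app; exact: cvg_within.
apply: cvg_trans FF; apply: near_eq_cvg.
rewrite !near_withinE; near=> y => Ay; apply: FE => //; near: y.
exact: open_nbhs_nbhs.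
Unshelve. all: by end_near.
Qed.

Lemma unit_sphere_compact n : compact (unit_sphere R n).
Proof.
apply: bounded_closed_compact.
  exists 1; split; first exact: num_real.
  move=> t t1 x; rewrite /unit_sphere/= => x1; apply: (le_trans _ (ltW t1)).
  rewrite /Num.norm/= mx_normrE; apply: bigmax_le => //= -[i j] _ /=.
  rewrite ord1 -(@ler_pXn2r _ 2)// ?nnegrE// expr1n -normrX ger0_norm ?sqr_ge0//.
  rewrite -x1 (bigD1 j)//= lerDl; apply: sumr_ge0 => k _; exact: sqr_ge0.
have -> : unit_sphere R n = (fun x : 'rV[R]_n.+1 => \sum_i x 0 i ^+ 2) @^-1` [set 1] by [].
apply: closed_comp => [x _|]; last exact: closed_eq.
have -> : (fun x : 'rV[R]_n.+1 => \sum_i x 0 i ^+ 2) =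
    \sum_i (fun x : 'rV[R]_n.+1 => x 0 i ^+ 2).
  by apply/funext => y; rewrite fct_sumE.
elim/big_ind: _ => [|f g cf cg|i _]; first exact: cst_continuous.
  exact: continuousD.
have cc : continuous (fun x : 'rV[R]_n.+1 => x 0 i : R) by exact: coord_continuous.
exact: (continuousM (cc _) (cc _)).
Qed.

Lemma sphere_compact n (M : set (ambient R n)) :
  diffeomorphic M (unit_sphere R n) -> compact M /\ M !=set0.
Proof.
move=> [f [g [sf sg [fM gS] gf fg]]]; split.
  have -> : M = g @` unit_sphere R n.
    apply/seteqP; split=> [p Mp|p [x Sx <-]]; last exact: gS.
    by exists (f p); [exact: fM | exact: gf].
  by apply: continuous_compact; [exact: smooth_map_continuous | exact: unit_sphere_compact].
exists (g (delta_mx 0 0)); apply: gS; rewrite /unit_sphere/= (bigD1 0)//= big1.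
  by rewrite mxE !eqxx expr1n addr0.
by move=> i i0; rewrite mxE (negPf i0) expr0n.
Qed.

End Compactness.

(** * A barrier function *)

Section Barrier.
Variables (R : realType) (s : space_form) (n : nat).
Local Notation ambient := (ambient R n).
Local Notation vec := (vec R n).
Local Notation sgn := (sgn R s).
Local Notation qform := (@qform R s n).
Local Notation inner := (@inner R s n).

Lemma is_derive_expR_comp (V : normedModType R) (f : V -> R^o) x v df :
  is_derive x v f df -> is_derive x v (fun y => expR (f y) : R^o) (df * expR (f x)).
Proof.
move=> [dfx <-].
have d := @derivable_expR R (f x).
have dd : differentiable (expR : R^o -> R^o) (f x) by exact/derivable1_diffP.
have := is_derive_comp dfx dd; set u := 'D_v f x.
suff -> : 'D_u expR (f x) = u * expR (f x) by [].
rewrite (deriveE _ dd) -[X in 'd _ _ X]mulr1 [LHS]linearZ -(deriveE _ dd).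
exact: (congr1 (fun g : R -> R => u * g (f x)) (derive_expR R)).
Qed.

Lemma is_Ck_expR k : is_Ck k setT (expR : R^o -> R^o).
Proof.
elim: k => [|k IHk]; first by split=> // t _; exact: continuous_expR.
split=> [t _|v]; first exact: continuous_expR.
have D (t : R^o) := is_derive_expR_comp (is_derive_id t v).
split=> [t _|]; first by have [] := D t.
apply: (is_Ck_ext openT (f := (cst (v : R^o) : R^o -> R^o) * expR)).
  by move=> t _; have [_ ->] := D t.
by apply: is_Ck_mul => //; [exact: openT | exact: is_Ck_cst].
Qed.

Variables (o : vec) (lam C : R).

(** For positive [lam], on the slices it depends only on the distance to [o],
    and grows with it. The exponential makes the radial second derivative dominate, the quadratic term
    takes care of the vertical direction. *)
Definition barrier (q : ambient) : R^o := expR (- lam * qform q.1 o) + C * q.2 ^+ 2.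

(** The differential of [barrier] at [q] in the direction [w]. *)
Definition dbarrier (q w : ambient) : R :=
  - lam * qform w.1 o * expR (- lam * qform q.1 o) + 2 * C * q.2 * w.2.

Lemma dbarrierD q w w' : dbarrier q (w + w') = dbarrier q w + dbarrier q w'.
Proof. by rewrite /dbarrier qformDl [(w + w').2]/=; ring. Qed.

Lemma dbarrierZ q a w : dbarrier q (a *: w) = a * dbarrier q w.
Proof.
have wE : (a *: w).2 = a * w.2 :> R by [].
by rewrite /dbarrier qformZl wE; ring.
Qed.

Lemma dbarrier0 q : dbarrier q 0 = 0.
Proof. by rewrite -(scale0r (0 : ambient)) dbarrierZ mul0r. Qed.

Lemma dbarrier_horiz q p :
  dbarrier q (horiz p) = - lam * qform p.1 o * expR (- lam * qform q.1 o).
Proof. by rewrite /dbarrier [(horiz p).2]/= mulr0 addr0. Qed.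

Lemma is_Ck_barrier (V : normedModType R) k (U : set V) (g : V -> ambient) :
  open U -> is_Ck k U g -> is_Ck k U (barrier \o g).
Proof.
move=> oU Cg.
have Cc i : is_Ck k U (@amb_coord R n i \o g).
  by apply: is_Ck_linear => //; exact: amb_coord_continuous.
(* The exponent, written with coordinates to see that it is of class C^k. *)
pose l : V -> R^o := \sum_i ((cst (- lam * qsign R s i * o 0 i) : V -> R^o) * (@amb_coord R n (Some i) \o g)).
have Cl : is_Ck k U l.
  by apply: is_Ck_sum => // i; apply: is_Ck_mul => //; exact: is_Ck_cst.
have lE y : l y = - lam * qform (g y).1 o.
  rewrite /l fct_sumE qformE mulr_sumr; apply: eq_bigr => i _ /=.
  by rewrite /amb_coord; change (- lam * qsign R s i * o 0 i * (g y).1 0 i = - lam * (qsign R s i * ((g y).1 0 i * o 0 i))); ring.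
have Ce : is_Ck k U (expR \o l).
  exact: (is_Ck_comp (real_frame R) oU openT (fun _ _ => I) Cl (is_Ck_expR k)).
have Ch := is_Ck_mul oU (is_Ck_cst k U (C : R^o)) (is_Ck_mul oU (Cc None) (Cc None)).
apply: (is_Ck_ext oU _ (is_Ck_add oU Ce Ch)) => y _.
by rewrite /barrier /= -lE.
Qed.

Lemma barrier_continuous : continuous barrier.
Proof.
have [c _] : is_Ck 0 setT (barrier \o id).
  by apply: is_Ck_barrier; [exact: openT | split=> // x _; exact: cvg_id].
by move=> x; exact: c.
Qed.

Lemma is_derive_barrier (V : normedModType R) (g : V -> ambient) x v dg :
  is_derive x v g dg -> is_derive x v (barrier \o g) (dbarrier (g x) dg).
Proof.
move=> Dg.
have Dl := is_derive_qform s Dg (is_derive_cst ((o, 0) : ambient) x v).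
have De := is_derive_expR_comp (is_deriveZ (- lam) Dl).
have Dh := is_derive_linear (@amb_coord_continuous R n None) Dg.
have D := is_deriveD De (is_deriveZ C (is_deriveM Dh Dh)).
refine (is_derive_eq (f := barrier \o g) D _); rewrite /dbarrier /= qform0r addr0 /GRing.scale/=; ring.
Qed.

Lemma is_derive_dbarrier (V : normedModType R) (g w : V -> ambient) x v dg dw :
  is_derive x v g dg -> is_derive x v w dw ->
  is_derive x v (fun y => dbarrier (g y) (w y) : R^o)
    (dbarrier (g x) dw + lam ^+ 2 * expR (- lam * qform (g x).1 o) * (qform dg.1 o * qform (w x).1 o)
     + 2 * C * (dg.2 * (w x).2)).
Proof.
move=> Dg Dw.
have Dl := is_derive_qform s Dg (is_derive_cst ((o, 0) : ambient) x v).
have Dlw := is_derive_qform s Dw (is_derive_cst ((o, 0) : ambient) x v).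
have De := is_derive_expR_comp (is_deriveZ (- lam) Dl).
have Dh := is_derive_linear (@amb_coord_continuous R n None) Dg.
have Dhw := is_derive_linear (@amb_coord_continuous R n None) Dw.
have D := is_deriveD (is_deriveM (is_deriveZ (- lam) Dlw) De) (is_deriveM (is_deriveZ (2 * C) Dh) Dhw).
refine (is_derive_eq (f := fun y => dbarrier (g y) (w y) : R^o) D _); rewrite /dbarrier /= !qform0r !addr0 /GRing.scale/=; ring.
Qed.

End Barrier.

(** * Fundamental forms and adapted frames *)

Section CurvatureForm.
Variables (R : realType) (s : space_form) (n : nat).
Local Notation ambient := (ambient R n).
Local Notation sgn := (sgn R s).
Local Notation qform := (@qform R s n).
Local Notation inner := (@inner R s n).
Implicit Types (p Y Z W : ambient).

Lemma inner_sum2 (E : 'M[R]_n) (F F' : 'I_n -> ambient) a c :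
  inner (\sum_k E k a *: F k) (\sum_k E k c *: F' k) =
  \sum_i \sum_j E i a * E j c * inner (F i) (F' j).
Proof.
rewrite inner_suml; apply: eq_bigr => i _; rewrite inner_sumr; apply: eq_bigr => j _.
by rewrite innerZl innerZr; ring.
Qed.

Lemma curvature_inner p Y Z W : quadric s p.1 ->
  qform Y.1 p.1 = 0 -> qform Z.1 p.1 = 0 ->
  inner (curvature s p Y Z Z) W =
  sgn * (qform Z.1 Z.1 * qform W.1 Y.1 - qform Z.1 W.1 * qform Z.1 Y.1).
Proof.
move=> qp Yp Zp; rewrite curvatureE//.
rewrite innerZl innerDl innerNl !innerZl !(innerC s (horiz _)) !inner_horizontal.
by rewrite (qformC s W.1 Z.1) [X in _ - X]mulrC.
Qed.

Lemma sectional_congruence (E : 'M[R]_n) (t : 'I_n -> ambient) (Z : ambient) a :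
  let e := \sum_k E k a *: t k in
  \sum_i \sum_j E i a * E j a * (sgn *
      (qform Z.1 Z.1 * qform (t i).1 (t j).1 - qform Z.1 (t i).1 * qform Z.1 (t j).1)) =
  sgn * (qform Z.1 Z.1 * qform e.1 e.1 - qform Z.1 e.1 ^+ 2).
Proof.
move=> e; have qe : qform e.1 e.1 =
    \sum_i \sum_j E i a * E j a * qform (t i).1 (t j).1.
  have he : horiz e = \sum_k E k a *: horiz (t k).
    by rewrite /e linear_sum; apply: eq_bigr => k _; rewrite linearZ.
  rewrite -inner_horizontal -/(horiz e) he inner_sum2; apply: eq_bigr => i _; apply: eq_bigr => j _.
  by rewrite inner_horizontal.
have qN : qform Z.1 e.1 = \sum_i E i a * qform Z.1 (t i).1.
  rewrite qformC -inner_horizontal -/(horiz Z) inner_suml.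
  by apply: eq_bigr => i _; rewrite innerZl inner_horizontal qformC.
rewrite qe qN expr2 big_distrlr/= mulr_sumr -sumrB mulr_sumr.
apply: eq_bigr => i _; rewrite mulr_sumr -sumrB mulr_sumr.
by apply: eq_bigr => j _; ring.
Qed.

End CurvatureForm.

#[local] Opaque derive inner qform.

Section FundamentalForms.
Variables (R : realType) (s : space_form) (n : nat).
Local Notation ambient := (ambient R n).
Local Notation sgn := (sgn R s).
Local Notation qform := (@qform R s n).
Local Notation inner := (@inner R s n).
Variables (M : set ambient) (N : ambient -> ambient).
Hypotheses (hM : embedded_hypersurface s M) (hN : unit_normal s M N).
Variables (U : set 'rV[R]_n) (phi : 'rV[R]_n -> ambient) (x : 'rV[R]_n).
Hypotheses (hphi : local_param M U phi) (Ux : U x).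
Local Notation nu := (N \o phi).
Local Notation p := (phi x).
Implicit Types v w : 'rV[R]_n.

Let Mp : M p. Proof. exact: param_in hphi _ Ux. Qed.

Lemma normal_derive v : is_derive x v nu ('D_v nu x).
Proof.
have [sN _ _ _] := hN.
have [U' [_ U'x _ CN]] := smooth_on_param hphi (amb_frame R n) sN Ux.
exact/derivableP/(is_Ck_derivable (CN 1%N) U'x).
Qed.

Lemma tangent_derive v w : is_derive x v ('D_w phi) ('D_v ('D_w phi) x).
Proof.
exact/derivableP/(is_Ck_derivable (is_Ck_derive w (param_Ck hphi 2)) Ux).
Qed.

Lemma param_derive v : is_derive x v phi ('D_v phi x).
Proof. exact/derivableP/(param_derivable hphi Ux). Qed.

Lemma derive_on_param (f : 'rV[R]_n -> R^o) (a : R^o) v df :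
  (forall y, U y -> f y = a) -> is_derive x v f df -> df = 0.
Proof.
move=> fE [_ <-]; rewrite (near_eq_derive (g := cst a)) ?derive_cst//.
by apply: (near_eq_open (param_open hphi) Ux).
Qed.

(** Differentiate the orthogonality of the normal and [D_w phi] along [v]. *)
Lemma weingarten v w :
  inner ('D_v nu x) ('D_w phi x) = - inner (N p) ('D_v ('D_w phi) x).
Proof.
apply/eqP; rewrite -addr_eq0; apply/eqP.
apply: (derive_on_param (a := 0) _ (is_derive_inner s (normal_derive v) (tangent_derive v w))).
by move=> y Uy; exact: (normal_orthogonal hN hphi).
Qed.

(** The symmetry of the shape operator comes from that of the second derivatives
    of the parametrization. *)
Lemma weingarten_sym v w :
  inner ('D_v nu x) ('D_w phi x) = inner ('D_w nu x) ('D_v phi x).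
Proof.
apply: (etrans (weingarten v w)); apply: (etrans _ (esym (weingarten w v))).
apply: (congr1 (fun z => - inner (N p) z)).
exact: (schwarz_vec (amb_frame R n) _ _ (param_open hphi) (param_Ck hphi 2) Ux).
Qed.

Lemma normal_derive_normal v : inner ('D_v nu x) (N p) = 0.
Proof.
have := derive_on_param (a := 1) _ (is_derive_inner s (normal_derive v) (normal_derive v)).
rewrite (innerC s _ ('D_v nu x)) => /(_ _)/eqP; rewrite -mulr2n mulrn_eq0/= => H.
apply/eqP/H => y Uy; have [_ _ N1 _] := hN; apply: N1; exact: (param_in hphi).
Qed.

Lemma normal_derive_horizontal v :
  qform ('D_v nu x).1 p.1 = - qform (N p).1 ('D_v phi x).1.
Proof.
apply/eqP; rewrite -addr_eq0; apply/eqP.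
apply: (derive_on_param (a := 0) _ (is_derive_qform s (normal_derive v) (param_derive v))).
by move=> y Uy; apply: (normal_horizontal hM hN); exact: (param_in hphi).
Qed.

Lemma acceleration_horizontal v w :
  qform ('D_v ('D_w phi) x).1 p.1 = - qform ('D_w phi x).1 ('D_v phi x).1.
Proof.
apply/eqP; rewrite -addr_eq0; apply/eqP.
apply: (derive_on_param (a := 0) _ (is_derive_qform s (tangent_derive v w) (param_derive v))).
by move=> y Uy; exact: (tangent_horizontal hM hphi).
Qed.

Local Notation G := (induced_metric s phi x).
Definition second_form : 'M[R]_n :=
  \matrix_(k, j) - inner (partial j nu x) (partial k phi x).
Local Notation B := second_form.

Lemma inner_tproj (q v w : ambient) : qform w.1 q.1 = 0 ->
  inner (tproj s q v) w = inner v w.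
Proof.
move=> wq; rewrite tprojE innerDl innerNl innerZl (innerC s (horiz q)).
by rewrite inner_horizontal wq mulr0 subr0.
Qed.

(** The tangential projection in [shape_op] does not change inner products with
    tangent vectors. *)
Lemma shape_opE : shape_op s N phi x = invmx G *m B.
Proof.
rewrite /shape_op /tangent_op; congr (_ *m _); apply/matrixP => k j; rewrite !mxE.
by rewrite innerNl inner_tproj// (tangent_horizontal hM hphi).
Qed.

Lemma metric_sym : G^T = G.
Proof.
apply/matrixP => i j.
rewrite mxE.
rewrite /induced_metric.
rewrite mxE.
rewrite [in RHS]mxE.
exact: innerC.
Qed.

Lemma second_form_sym : B^T = B.
Proof.
apply/matrixP => i j.
rewrite mxE.
rewrite /second_form.
rewrite mxE.
rewrite [in RHS]mxE.
rewrite /partial.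
exact: (congr1 -%R (weingarten_sym _ _)).
Qed.

Lemma tangent_inner_pos (v : ambient) : qform v.1 p.1 = 0 ->
  0 <= inner v v /\ (inner v v = 0 -> v = 0).
Proof.
move=> vp; have [q0 q_eq0] := quadric_normal_pos (hM.1 _ Mp) vp.
have t0 : 0 <= v.2 * v.2 :> R by rewrite -expr2 sqr_ge0.
rewrite innerE; split; first exact: addr_ge0.
move/eqP; rewrite paddr_eq0// => /andP[/eqP/q_eq0 v1 /eqP v2].
case: v v1 v2 {vp q0 q_eq0 t0} => v t /= -> /eqP; rewrite -expr2 sqrf_eq0 => /eqP ->//.
Qed.

Lemma congruence_entry (b : 'I_n -> 'I_n -> R) (E : 'M[R]_n) a c :
  (E^T *m (\matrix_(i, j) b i j) *m E) a c = \sum_i \sum_j E i a * E j c * b i j.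
Proof.
rewrite mxE exchange_big/=; apply: eq_bigr => j _; rewrite mxE mulr_suml.
by apply: eq_bigr => i _; rewrite !mxE; ring.
Qed.

Lemma param_derive_col (E : 'M[R]_n) a :
  'D_((col a E)^T) phi x = \sum_k E k a *: partial k phi x.
Proof.
rewrite (param_derive_sum hphi _ Ux); apply: eq_bigr => k _; by rewrite !mxE.
Qed.

Lemma normal_derive_col (E : 'M[R]_n) a :
  'D_((col a E)^T) nu x = \sum_k E k a *: partial k nu x.
Proof.
have [sN _ _ _] := hN.
have [U' [oU' U'x _ CN]] := smooth_on_param hphi (amb_frame R n) sN Ux.
rewrite (derive_frame_vec (rV_frame R n) (amb_frame R n) _ oU' (CN 1%N) U'x).
by apply: eq_bigr => k _; rewrite /= /rV_coord !mxE.
Qed.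

Lemma metric_col (E : 'M[R]_n) a c : (E^T *m G *m E) a c =
  inner ('D_((col a E)^T) phi x) ('D_((col c E)^T) phi x).
Proof. by rewrite congruence_entry !param_derive_col inner_sum2. Qed.

Lemma second_form_col (E : 'M[R]_n) a c : (E^T *m B *m E) a c =
  - inner ('D_((col c E)^T) nu x) ('D_((col a E)^T) phi x).
Proof.
rewrite congruence_entry param_derive_col normal_derive_col inner_sum2 -sumrN exchange_big/=.
apply: eq_bigr => i _; rewrite -sumrN; apply: eq_bigr => j _; ring.
Qed.

Lemma metric_posdef : posdef_mx G.
Proof.
move=> v v0; have := tangent_inner_pos (tangent_horizontal hM hphi v^T Ux).
have -> : (v^T *m G *m v) 0 0 = inner ('D_(v^T) phi x) ('D_(v^T) phi x).
  rewrite (param_derive_sum hphi _ Ux) inner_sumr mxE.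
  apply: eq_bigr => j _; rewrite innerZr inner_suml mxE mulr_suml mulr_sumr.
  by apply: eq_bigr => i _; rewrite innerZl !mxE; ring.
move=> [h h0]; rewrite lt_def h andbT; apply: contra v0 => /eqP/h0/(param_immersion hphi Ux) vT0.
by rewrite -[v]trmxK vT0 trmx0.
Qed.

Section AdaptedFrame.
Variables (E : 'M[R]_n) (d : 'rV[R]_n).
Hypotheses (EG : E^T *m G *m E = 1%:M) (EB : E^T *m B *m E = diag_mx d).
Local Notation e a := ('D_((col a E)^T) phi x).

Lemma adapted_orthonormal a c : inner (e a) (e c) = (a == c)%:R.
Proof. by rewrite -metric_col EG mxE. Qed.

(** The columns of [E] give an orthonormal basis of the tangent space of [M];
    with the normal and the position vector there are enough vectors to span the
    ambient vector space. *)
Lemma adapted_expansion (w : ambient) :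
  w = (sgn * qform w.1 p.1) *: horiz p + inner w (N p) *: N p +
      \sum_a inner w (e a) *: e a.
Proof.
(* Index 0 is the position vector and index 1 the normal. *)
pose b (i : 'I_n.+2) : ambient := match unlift ord0 i with
  | None => horiz p
  | Some j => match unlift ord0 j with None => N p | Some a => e a end end.
pose eps (i : 'I_n.+2) : R := if unlift ord0 i is Some _ then 1 else sgn.
have [pp _] := hM.1 _ Mp; rewrite -/(qform p.1 p.1) in pp.
have [_ _ /(_ _ Mp) NN _] := hN.
have Np := normal_horizontal hM hN Mp.
rewrite {1}(@orthonormal_expansion R s n b eps w).
- rewrite !big_ord_recl /b /eps !unlift_none !liftK !unlift_none !mul1r inner_horizontal -addrA.
  by congr (_ + (_ + _)); apply: eq_bigr => a _; rewrite !liftK mul1r.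
- by move=> i; rewrite /eps; case: unlift => *; rewrite ?mulr1 ?sgn_sqr.
move=> i j; rewrite /b /eps.
case: (unliftP ord0 i) => [i' ->|->]; case: (unliftP ord0 j) => [j' ->|->]; rewrite ?eqxx ?(inj_eq lift_inj) ?[lift _ _ == _]eq_sym ?(negPf (neq_lift _ _)).
- case: (unliftP ord0 i') => [a ->|->]; case: (unliftP ord0 j') => [c ->|->]; rewrite ?eqxx ?(inj_eq lift_inj) ?[lift _ _ == _]eq_sym ?(negPf (neq_lift _ _)).
  + exact: adapted_orthonormal.
  + by rewrite innerC (normal_orthogonal hN hphi).
  + by rewrite (normal_orthogonal hN hphi).
  + exact: NN.
- rewrite inner_horizontal; case: unliftP => [a _|_] //.
  exact: (tangent_horizontal hM hphi).
- rewrite innerC inner_horizontal; case: unliftP => [a _|_] //.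
  exact: (tangent_horizontal hM hphi).
- by rewrite inner_horizontal.
Qed.

(** Besides the shape operator there is a component along the position vector,
    because the derivative of the normal is taken in the ambient vector space. *)
Lemma adapted_weingarten a : 'D_((col a E)^T) nu x =
  - d 0 a *: e a - (sgn * qform (N p).1 (e a).1) *: horiz p.
Proof.
rewrite [LHS]adapted_expansion normal_derive_horizontal normal_derive_normal.
rewrite scale0r addr0 mulrN scaleNr addrC; congr (_ - _).
rewrite (bigD1 a)//= big1 ?addr0.
  by rewrite -[inner _ _]opprK -second_form_col EB !mxE eqxx.
move=> c ca; rewrite -[inner _ _]opprK -second_form_col EB !mxE.
by rewrite (negPf ca) mulr0n oppr0 scale0r.
Qed.

Lemma curvature_opE : exists C : 'M[R]_n,
  curvature_op s N phi x = invmx G *m C /\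
  forall a, (E^T *m C *m E) a a =
    sgn * (qform (N p).1 (N p).1 * qform (e a).1 (e a).1 - qform (N p).1 (e a).1 ^+ 2).
Proof.
have qp := hM.1 _ Mp; have Np := normal_horizontal hM hN Mp.
rewrite /curvature_op /tangent_op; eexists; split; first reflexivity.
move=> a; rewrite congruence_entry param_derive_col -sectional_congruence.
apply: eq_bigr => i _; apply: eq_bigr => j _.
apply: (congr1 (fun z => E i a * E j a * z)).
exact: (@curvature_inner R s n p (partial j phi x) (N p) (partial i phi x) qp (tangent_horizontal hM hphi _ Ux) Np).
Qed.

End AdaptedFrame.
End FundamentalForms.

(** * Rotational symmetry in the hyperbolic case *)

(** The numbers are the components of the normal [beta v - gamma o] and of a
    principal direction [Y + eta v - zeta o] at the point [C o + S v] at
    distance [rho] from [o], with [C] and [S] the hyperbolic cosine and sine of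
    [rho] and [m] the squared length of [Y]. If [m] is nonzero then [beta = - D
    S], hence [K = D^2 m S^2 / C^2], which is at most [D^2 S^2 / C^2] since [m
    <= 1]. *)
Lemma off_axis_inequality (R : realType) (C S beta gamma eta zeta m t D : R) :
  0 < C -> 0 < S -> C ^+ 2 - S ^+ 2 = 1 -> C * gamma + S * beta = 0 ->
  C * zeta + S * eta = 0 -> 0 <= m -> D * (S * m) = - (m * beta) ->
  m + eta ^+ 2 - zeta ^+ 2 + t ^+ 2 = 1 ->
  let K := (beta ^+ 2 - gamma ^+ 2) * (m + eta ^+ 2 - zeta ^+ 2) -
           (beta * eta - gamma * zeta) ^+ 2 in
  0 <= D ^+ 2 - K /\ (D ^+ 2 - K = 0 -> D = 0).
Proof.
move=> C0 S0 CS g_b z_e m0 Dm norm1 K.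
have Cn0 : C != 0 by rewrite gt_eqF.
have gE : gamma = - (S * beta / C) by apply: (mulfI Cn0); rewrite mulrN [C * (_ / C)]mulrC divfK//; lra.
have zE : zeta = - (S * eta / C) by apply: (mulfI Cn0); rewrite mulrN [C * (_ / C)]mulrC divfK//; lra.
have C2 : C ^+ 2 = 1 + S ^+ 2 by lra.
have KE : C ^+ 2 * K = beta ^+ 2 * m.
  have -> : C ^+ 2 * K = (C ^+ 2 - S ^+ 2) * (beta ^+ 2 * m).
    by rewrite /K gE zE; field.
  by rewrite CS mul1r.
have m1 : m <= 1.
  have : C ^+ 2 * (eta ^+ 2 - zeta ^+ 2) = eta ^+ 2.
    have -> : C ^+ 2 * (eta ^+ 2 - zeta ^+ 2) = (C ^+ 2 - S ^+ 2) * eta ^+ 2.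
      by rewrite zE; field.
    by rewrite CS mul1r.
  move=> h; have : 0 <= eta ^+ 2 - zeta ^+ 2.
    by rewrite -(pmulr_rge0 _ (exprn_gt0 2 C0)) h sqr_ge0.
  by have := sqr_ge0 t; lra.
have [m_eq0|m_neq0] := eqVneq m 0.
  have -> : K = 0.
    by apply: (mulfI (expf_neq0 2 Cn0)); rewrite KE m_eq0 !mulr0.
  by rewrite subr0 sqr_ge0; split=> // /eqP; rewrite sqrf_eq0 => /eqP.
have bE : beta = - (D * S).
  apply: (mulfI m_neq0); rewrite mulrN -[LHS]opprK -Dm; congr (- _); ring.
have main : C ^+ 2 * (D ^+ 2 - K) = D ^+ 2 * (C ^+ 2 - S ^+ 2 * m).
  by rewrite mulrBr KE bE; ring.
have pos : 0 < C ^+ 2 - S ^+ 2 * m.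
  have : S ^+ 2 * m <= S ^+ 2 by rewrite ler_piMr// sqr_ge0.
  by rewrite C2; lra.
split.
  by rewrite -(pmulr_rge0 _ (exprn_gt0 2 C0)) main mulr_ge0// ?sqr_ge0// ltW.
move=> h0; move/eqP: main; rewrite h0 mulr0 eq_sym mulf_eq0 sqrf_eq0 (gt_eqF pos) orbF.
by move/eqP.
Qed.

Section RotationalSymmetry.
Variables (R : realType) (n : nat).
Local Notation ambient := (ambient R n).
Local Notation vec := (vec R n).
Local Notation qform := (@qform R Hyperbolic n).
Local Notation inner := (@inner R Hyperbolic n).
Local Notation cosh rho := ((expR rho + expR (- rho)) / 2).
Local Notation sinh rho := ((expR rho - expR (- rho)) / 2).
Variables (M : set ambient) (N : ambient -> ambient) (o : vec).
Hypotheses (hM : embedded_hypersurface Hyperbolic M) (hN : unit_normal Hyperbolic M N).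
Hypotheses (ho : quadric Hyperbolic o) (hrot : rotational Hyperbolic o M).

Let oo : qform o o = -1. Proof. by case: ho. Qed.

Lemma cosh2_sinh2 (rho : R) : cosh rho ^+ 2 - sinh rho ^+ 2 = 1.
Proof.
have := expRxMexpNx_1 rho; set a := expR rho; set b := expR (- rho) => ab.
have -> : ((a + b) / 2) ^+ 2 - ((a - b) / 2) ^+ 2 = a * b by field.
exact: ab.
Qed.

Lemma sinh_gt0 (rho : R) : 0 < rho -> 0 < sinh rho.
Proof. by move=> r0; rewrite divr_gt0// subr_gt0 ltr_expR; lra. Qed.

Lemma cosh_gt0 (rho : R) : 0 < cosh rho.
Proof. by rewrite divr_gt0// addr_gt0// expR_gt0. Qed.

(** With [p], the leaf contains the curve obtained by rotating the direction [v]
    towards [z]; its velocity at [p] is a nonzero multiple of [z]. *)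
Lemma off_axis p : M p -> p.1 != o -> exists rho v,
  [/\ 0 < rho, qform v o = 0, qform v v = 1, p.1 = cosh rho *: o + sinh rho *: v &
      forall z, qform z o = 0 -> qform z v = 0 -> qform (N p).1 z = 0].
Proof.
move=> Mp po; have [/eqP|[rho [t [r0 _ [v [vo vv pE]] sub]]]] := hrot Mp; first by rewrite (negPf po).
exists rho, v; split => //; first by rewrite pE.
move=> z zo zv; have [zz zz0] := quadric_normal_pos ho zo.
have [/zz0 ->|zz_neq0] := eqVneq (qform z z) 0; first by rewrite qform0r.
pose k := Num.sqrt (qform z z).
have k0 : 0 < k by rewrite sqrtr_gt0 lt_def zz_neq0.
have k2 : k ^+ 2 = qform z z by rewrite sqr_sqrtr.
pose c (tau : R^o) : ambient := (cosh rho *: o, t : R^o) +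
   ((sinh rho * cos tau) *: ((v, 0) : ambient) + (sinh rho / k * sin tau) *: ((z, 0) : ambient)).
have cM tau : M (c tau).
  apply: sub; exists (cos tau *: v + (sin tau / k) *: z); split.
  - by rewrite !qformL vo zo !mulr0 addr0.
  - rewrite !(qformL, qformR) vv zv (qformC Hyperbolic v) zv -k2 !mulr0 addr0 add0r mulr1.
    rewrite -[RHS](cos2Dsin2 tau); field; exact: lt0r_neq0.
  - rewrite /c /geodesic; congr pair; last by rewrite /= !scaler0 !addr0.
    rewrite /= [in RHS]scalerDr !scalerA; congr (_ + (_ + _ *: _)).
    by field; exact: lt0r_neq0.
have c0 : c 0 = p.
  rewrite /c cos0 sin0 mulr0 scale0r addr0 mulr1 pE /geodesic.
  by congr pair; rewrite /= scaler0 addr0.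
have Dc : is_derive (0 : R^o) 1 c ((sinh rho / k) *: ((z, 0) : ambient)).
  have D1 : is_derive (0 : R^o) 1 (fun tau : R^o => sinh rho * cos tau : R^o) 0.
    have := is_deriveZ (sinh rho) (is_derive_cos (0 : R)).
    by rewrite sin0 oppr0 scaler0.
  have D2 : is_derive (0 : R^o) 1 (fun tau : R^o => sinh rho / k * sin tau : R^o) (sinh rho / k).
    have := is_deriveZ (sinh rho / k) (is_derive_sin (0 : R)).
    by rewrite cos0 [_ *: 1]mulr1.
  have fr := amb_frame R n.
  have := is_deriveD (is_derive_cst ((cosh rho *: o, t : R^o) : ambient) (0 : R^o) 1)
    (is_deriveD (is_derive_scale fr D1 (is_derive_cst ((v, 0) : ambient) (0 : R^o) 1))
                (is_derive_scale fr D2 (is_derive_cst ((z, 0) : ambient) (0 : R^o) 1))).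
  by rewrite !scaler0 !scale0r !add0r.
have ncM : \forall tau \near (0 : R^o), M (c tau) by near=> tau; exact: cM.
have := normal_curve hM hN Dc ncM; rewrite c0 innerZr inner_horizontal => /eqP.
have /negPf sk : sinh rho / k != 0 by rewrite gt_eqF// divr_gt0// sinh_gt0.
by rewrite mulf_eq0 sk/= => /eqP.
Unshelve. all: by end_near.
Qed.

(** For [a] and [b] orthogonal to [o], the field with value [<a,x> b - <b,x> a]
    at [x] generates rotations about the axis, which preserve the leaves. So it
    is tangent to [M]. *)
Lemma normal_rotation p a b : M p -> qform a o = 0 -> qform b o = 0 ->
  qform a p.1 * qform (N p).1 b - qform b p.1 * qform (N p).1 a = 0.
Proof.
move=> Mp ao bo; have [po|po] := eqVneq p.1 o.
  by rewrite po ao bo !mul0r subrr.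
have [rho [v [r0 vo vv pE tan]]] := off_axis Mp po.
have := tan (qform a v *: b - qform b v *: a).
rewrite !(qformL, qformR) ao bo !mulr0 subrr => /(_ erefl).
rewrite (mulrC (qform b v)) subrr => /(_ erefl) h.
by rewrite pE !qformR ao bo !mulr0 !add0r -!(mulrA (sinh rho)) -mulrBr h mulr0.
Qed.

Variables (U : set 'rV[R]_n) (phi : 'rV[R]_n -> ambient) (x : 'rV[R]_n).
Hypotheses (hphi : local_param M U phi) (Ux : U x).
Local Notation p := (phi x).
Let Mp : M p. Proof. exact: param_in hphi _ Ux. Qed.

Lemma normal_rotation_derive w a b : qform a o = 0 -> qform b o = 0 ->
  let e := 'D_w phi x in let dn := 'D_w (N \o phi) x in
  qform a e.1 * qform (N p).1 b + qform a p.1 * qform dn.1 b =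
  qform b e.1 * qform (N p).1 a + qform b p.1 * qform dn.1 a.
Proof.
move=> ao bo e dn; apply/eqP; rewrite -subr_eq0; apply/eqP.
have D (c : vec) : is_derive x w (fun y => qform c (phi y).1 : R^o) (qform c e.1).
  have := is_derive_qform Hyperbolic (is_derive_cst ((c, 0) : ambient) x w) (param_derive hphi Ux w).
  by rewrite qform0l add0r.
have DN (c : vec) : is_derive x w (fun y => qform (N (phi y)).1 c : R^o) (qform dn.1 c).
  have := is_derive_qform Hyperbolic (normal_derive hN hphi Ux w) (is_derive_cst ((c, 0) : ambient) x w).
  by rewrite qform0r addr0.
have H := is_deriveB (is_deriveM (D a) (DN b)) (is_deriveM (D b) (DN a)).
have := derive_on_param hphi Ux (a := 0) _ H.
move=> H0; rewrite -[RHS]H0; last first.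
  by move=> y Uy; apply: normal_rotation => //; exact: (param_in hphi).
by rewrite /GRing.scale/=; ring.
Qed.

Variables (E : 'M[R]_n) (d : 'rV[R]_n) (i : 'I_n).
Hypotheses (EG : E^T *m induced_metric Hyperbolic phi x *m E = 1%:M).
Hypotheses (EB : E^T *m second_form Hyperbolic N phi x *m E = diag_mx d).
Local Notation e := ('D_((col i E)^T) phi x).

(** This is [normal_rotation], differentiated along a principal direction. The
    components of the derivative of the normal along the position vector cancel. *)
Lemma principal_rotation a b : qform a o = 0 -> qform b o = 0 ->
  d 0 i * (qform a p.1 * qform e.1 b - qform b p.1 * qform e.1 a) =
  qform a e.1 * qform (N p).1 b - qform b e.1 * qform (N p).1 a.
Proof.
move=> ao bo; have := normal_rotation_derive (col i E)^T ao bo.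
rewrite (adapted_weingarten hM hN hphi Ux EG EB)/= !(qformL, qformNl).
rewrite /sgn (qformC Hyperbolic p.1 a) (qformC Hyperbolic p.1 b) => h.
by apply/eqP; rewrite -subr_eq0; apply/eqP; move/eqP: h; rewrite -subr_eq0 => /eqP h; apply: oppr_inj; rewrite oppr0 -[RHS]h; ring.
Qed.

Let n_ := (N p).1.
Let e_ := e.1.

(** On the axis the normal and the principal direction are both orthogonal to
    [o], and serve as [a] and [b] in [principal_rotation]; the rotation field
    vanishes there, so the normal and the direction have parallel horizontal
    parts. *)
Lemma axis_curvature : p.1 = o ->
  qform n_ n_ * qform e_ e_ - qform n_ e_ ^+ 2 = 0.
Proof.
move=> po; have no : qform n_ o = 0 by rewrite -po (normal_horizontal hM hN Mp).
have eo : qform e_ o = 0 by rewrite -po (tangent_horizontal hM hphi).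
have := principal_rotation no eo; rewrite po no eo !mul0r subrr mulr0.
rewrite -/n_ -/e_ => h.
by rewrite -[RHS]oppr0 h; ring.
Qed.

(** The ambient curvature [- K] may be negative. Off the axis, a direction
    tangent to the leaf has principal curvature [<N, v> / sinh rho] up to sign,
    whose square is at least the squared horizontal length of the normal, that
    is, the corresponding [K]. The profile direction and the normal span a flat
    plane. For a principal direction with components of both kinds,
    [principal_rotation] with [a = v] and [b = Y] gives the relation needed in
    [off_axis_inequality]. *)
Lemma hyperbolic_jacobi_term :
  let K := qform n_ n_ * qform e_ e_ - qform n_ e_ ^+ 2 in
  0 <= d 0 i ^+ 2 - K /\ (d 0 i ^+ 2 - K = 0 -> d 0 i = 0).
Proof.
have [po|po] := eqVneq p.1 o.
  rewrite /= axis_curvature// subr0 sqr_ge0; split=> // /eqP.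
  by rewrite sqrf_eq0 => /eqP.
have [rho [v [r0 vo vv pE tan]]] := off_axis Mp po.
have ov : qform o v = 0 by rewrite qformC.
have np : qform n_ p.1 = 0 by exact: (normal_horizontal hM hN Mp).
have ep : qform e_ p.1 = 0 by exact: (tangent_horizontal hM hphi).
have nE : n_ = qform n_ v *: v - qform n_ o *: o.
  pose z := n_ - qform n_ v *: v + qform n_ o *: o.
  have zo : qform z o = 0 by rewrite /z qformDl qformBl !qformZl vo oo; ring.
  have zv : qform z v = 0 by rewrite /z qformDl qformBl !qformZl vv ov; ring.
  have nz := tan z zo zv.
  have zz : qform z z = 0.
    rewrite {1}/z qformDl qformBl !qformZl -/n_ nz.
    by rewrite (qformC Hyperbolic v) (qformC Hyperbolic o) zo zv; ring.
  have [_ /(_ zz) z0] := quadric_normal_pos ho zo.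
  apply/eqP; rewrite -subr_eq0; apply/eqP; rewrite -[RHS]z0 /z.
  by rewrite opprB addrA addrAC.
pose Y := e_ - qform e_ v *: v + qform e_ o *: o.
have Yo : qform Y o = 0 by rewrite /Y qformDl qformBl !qformZl vo oo; ring.
have Yv : qform Y v = 0 by rewrite /Y qformDl qformBl !qformZl vv ov; ring.
have eE : e_ = Y + qform e_ v *: v - qform e_ o *: o by rewrite /Y addrAC addrK subrK.
have eY : qform e_ Y = qform Y Y.
  rewrite {1}eE qformBl qformDl !qformZl.
  by rewrite (qformC Hyperbolic v) (qformC Hyperbolic o) Yo Yv; ring.
have [m0 _] := quadric_normal_pos ho Yo.
have ee : qform e_ e_ = qform Y Y + qform e_ v ^+ 2 - qform e_ o ^+ 2.
  by rewrite {2}eE qformBr qformDr !qformZr eY; ring.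
have nn : qform n_ n_ = qform n_ v ^+ 2 - qform n_ o ^+ 2.
  by rewrite {2}nE qformBr !qformZr; ring.
have ne : qform n_ e_ = qform n_ v * qform e_ v - qform n_ o * qform e_ o.
  rewrite qformC {1}nE qformBr !qformZr; ring.
have nY : qform n_ Y = 0 by exact: tan.
have Yp : qform Y p.1 = 0 by rewrite pE qformDr !qformZr Yo Yv; ring.
have vp : qform v p.1 = sinh rho by rewrite pE qformDr !qformZr vo vv; ring.
have := principal_rotation vo Yo; rewrite -/n_ -/e_ vp Yp nY (qformC Hyperbolic Y e_) eY mulr0 mul0r subr0 sub0r => rot.
have norm1 := adapted_orthonormal hphi Ux EG i i; rewrite innerE eqxx -/e_ ee in norm1.
rewrite /= nn ee ne.
apply: (@off_axis_inequality R (cosh rho) (sinh rho) _ _ _ _ _ e.2) => //.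
- exact: cosh_gt0.
- exact: sinh_gt0.
- exact: cosh2_sinh2.
- by rewrite -np pE qformDr !qformZr.
- by rewrite -ep pE qformDr !qformZr.
Qed.

End RotationalSymmetry.

(** * No compact minimal rotational hypersurfaces *)

Section SecondVariation.
Variables (R : realType) (s : space_form) (n : nat).
Local Notation ambient := (ambient R n).
Local Notation vec := (vec R n).
Local Notation sgn := (sgn R s).
Local Notation qform := (@qform R s n).
Local Notation inner := (@inner R s n).
Variables (M : set ambient) (N : ambient -> ambient).
Hypotheses (hM : embedded_hypersurface s M) (hN : unit_normal s M N).
Variables (U : set 'rV[R]_n) (phi : 'rV[R]_n -> ambient) (x : 'rV[R]_n).
Hypotheses (hphi : local_param M U phi) (Ux : U x).
Local Notation p := (phi x).
Variables (E : 'M[R]_n) (d : 'rV[R]_n).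
Hypotheses (EG : E^T *m induced_metric s phi x *m E = 1%:M).
Hypotheses (EB : E^T *m second_form s N phi x *m E = diag_mx d).
Local Notation v a := ((col a E)^T).
Local Notation e a := ('D_(v a) phi x).

Let Mp : M p. Proof. exact: param_in hphi _ Ux. Qed.

Lemma adapted_parseval (w : ambient) :
  inner w w = sgn * qform w.1 p.1 ^+ 2 + inner w (N p) ^+ 2 + \sum_a inner w (e a) ^+ 2.
Proof.
rewrite {1}(adapted_expansion hM hN hphi Ux EG w) !innerDl !innerZl inner_suml.
rewrite (innerC s (horiz p)) inner_horizontal (innerC s (N p)).
congr (_ + _ + _); first by ring.
by apply: eq_bigr => a _; rewrite innerZl (innerC s _ w).
Qed.

Section BarrierMaximum.
Variables (o : vec) (lam C : R).
Local Notation barrier := (@barrier R s n o lam C).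
Local Notation dbarrier := (@dbarrier R s n o lam C).
Hypothesis barrier_max : forall q, M q -> barrier q <= barrier p.

Lemma barrier_maximum w :
  dbarrier p ('D_w phi x) = 0 /\
  dbarrier p ('D_w ('D_w phi) x) +
    lam ^+ 2 * expR (- lam * qform p.1 o) * qform ('D_w phi x).1 o ^+ 2 +
    2 * C * ('D_w phi x).2 ^+ 2 <= 0.
Proof.
have oU := param_open hphi.
pose F : 'rV[R]_n -> R^o := - (barrier \o phi).
have CF : is_Ck 2 U F.
  have := is_Ck_mul oU (is_Ck_cst 2 U (-1 : R^o)) (is_Ck_barrier s o lam C oU (param_Ck hphi 2)).
  by apply: is_Ck_ext => // y _; rewrite /F/= -[RHS]mulN1r.
have [|D1 D2] := second_derivative_test w oU CF Ux.
  by move=> y Uy; rewrite /F lerN2; apply: barrier_max; exact: (param_in hphi).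
have DF y : U y -> is_derive y w F (- dbarrier (phi y) ('D_w phi y)).
  move=> Uy; apply: is_deriveN; exact: (is_derive_barrier s o lam C (param_derive hphi Uy w)).
have D1E : 'D_w F x = - dbarrier p ('D_w phi x) by case: (DF x Ux) => _ DFx; exact: DFx.
have D2E := is_deriveN (is_derive_dbarrier s o lam C (param_derive hphi Ux w) (tangent_derive hphi Ux w w)).
have DDE : 'D_w ('D_w F) x = 'D_w (- (fun y => dbarrier (phi y) ('D_w phi y) : R^o)) x.
  apply: near_eq_derive; apply: (near_eq_open oU Ux) => y Uy.
  by case: (DF y Uy) => _ DFy; exact: DFy.
split; first by apply/eqP; rewrite -oppr_eq0 -D1E D1.
move: D2; rewrite DDE; have [_ ->] := D2E.
by rewrite oppr_ge0 -!expr2.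
Qed.

(** At the maximum the differential of the barrier vanishes on tangent vectors.
    In the second derivatives of [phi] along the frame, only the components
    along the normal and along the position vector contribute. The normal ones
    add up to a multiple of the mean curvature, which is zero. *)
Lemma barrier_second_variation : \sum_a d 0 a = 0 ->
  \sum_a (lam ^+ 2 * expR (- lam * qform p.1 o) * qform (e a).1 o ^+ 2 +
    2 * C * (e a).2 ^+ 2 +
    sgn * lam * expR (- lam * qform p.1 o) * qform p.1 o * qform (e a).1 (e a).1) <= 0.
Proof.
move=> d0; set g := expR _; set l := qform p.1 o.
have dbarrier_expansion w (qe da : R) : qform w.1 p.1 = - qe -> inner w (N p) = da ->
    dbarrier p w = sgn * lam * g * l * qe + da * dbarrier p (N p).
  move=> wp wN; rewrite {1}(adapted_expansion hM hN hphi Ux EG w).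
  rewrite 2!dbarrierD 2!dbarrierZ wp wN.
  have -> : dbarrier p (\sum_b inner w (e b) *: e b) = 0.
    elim/big_ind: _ => [|w1 w2 w10 w20|b _]; first exact: dbarrier0.
      by rewrite dbarrierD w10 w20 addr0.
    by rewrite dbarrierZ (barrier_maximum (v b)).1 mulr0.
  rewrite dbarrier_horiz -/g -/l addr0; congr (_ + _); ring.
have acc a : dbarrier p ('D_(v a) ('D_(v a) phi) x) =
    sgn * lam * g * l * qform (e a).1 (e a).1 + d 0 a * dbarrier p (N p).
  apply: dbarrier_expansion; first exact: (acceleration_horizontal hM hphi Ux).
  have ->: d 0 a = (E^T *m second_form s N phi x *m E) a a by rewrite EB mxE eqxx mulr1n.
  apply: (etrans _ (esym (second_form_col hN hphi Ux E a a))).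
  apply: (etrans (innerC s _ _)); apply: esym.
  by apply: (etrans (congr1 -%R (weingarten hN hphi Ux (v a) (v a)))); rewrite opprK.
have -> : \sum_a (lam ^+ 2 * g * qform (e a).1 o ^+ 2 + 2 * C * (e a).2 ^+ 2 +
    sgn * lam * g * l * qform (e a).1 (e a).1) =
  \sum_a (dbarrier p ('D_(v a) ('D_(v a) phi) x) +
    lam ^+ 2 * g * qform (e a).1 o ^+ 2 + 2 * C * (e a).2 ^+ 2).
  transitivity (\sum_a (lam ^+ 2 * g * qform (e a).1 o ^+ 2 + 2 * C * (e a).2 ^+ 2 +
    sgn * lam * g * l * qform (e a).1 (e a).1) + \sum_a d 0 a * dbarrier p (N p)).
    by rewrite -mulr_suml d0 mul0r addr0.
  rewrite -big_split/=; apply: eq_bigr => a _; rewrite acc; ring.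
by apply: sumr_le0 => a _; exact: (barrier_maximum (v a)).2.
Qed.

End BarrierMaximum.
End SecondVariation.

Section SphericalEstimate.
Variable R : realType.

(** The loss incurred where the tangent plane is not horizontal is proportional
    to [delta] and is absorbed by the term with [C]. *)
Lemma spherical_estimate (lam g K C delta L l m : R) :
  0 < lam -> 0 < g -> g <= K -> C = lam * (lam + 1) * K ->
  0 <= delta -> l ^+ 2 <= 1 -> (1 - l ^+ 2) * (1 - delta) <= L ->
  0 < lam * (1 - l ^+ 2) + m * l ->
  0 < lam ^+ 2 * g * L + 2 * C * delta + lam * g * l * (m - delta).
Proof.
move=> lam0 g0 gK CE delta0 l1 L_ge pos.
have lg : 0 < lam * g by rewrite mulr_gt0.
have main : 0 < lam * g * (lam * (1 - l ^+ 2) + m * l) by rewrite mulr_gt0.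
have h1 : lam * (lam * g) * ((1 - l ^+ 2) * (1 - delta)) <= lam * (lam * g) * L.
  by apply: ler_wpM2l => //; rewrite ltW// mulr_gt0.
have l_le1 : l <= 1 by have := sqr_ge0 (l - 1); rewrite sqrrB; nra.
have bracket : lam * (1 - l ^+ 2) + l <= lam + 1.
  by have : 0 <= lam * l ^+ 2 by [rewrite mulr_ge0// ?sqr_ge0// ltW]; lra.
have h2 : delta * (lam * g * (lam * (1 - l ^+ 2) + l)) <= delta * C.
  apply: ler_wpM2l => //; apply: (@le_trans _ _ (lam * g * (lam + 1))).
    by apply: ler_wpM2l => //; exact: ltW.
  rewrite CE -mulrA [g * _]mulrC mulrA; apply: ler_wpM2l => //.
  by rewrite ltW// mulr_gt0// addr_gt0.
have C0 : 0 <= delta * C.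
  by rewrite CE mulr_ge0// !mulr_ge0// ?addr_ge0//; [exact: ltW|exact: ltW|apply: le_trans (ltW g0) gK].
nra.
Qed.

End SphericalEstimate.

Section NoMinimalSphere.
Variables (R : realType) (n : nat).
Local Notation vec := (vec R n).
Local Notation ambient := (ambient R n).

(** The combination [b_0 a - a_0 b] has zeroth coordinate 0, so the form is
    nonnegative on it; expanding gives the sign. *)
Lemma hyperboloid_pairing_lt0 (a b : vec) : quadric Hyperbolic a -> quadric Hyperbolic b ->
  qform Hyperbolic a b < 0.
Proof.
move=> [aa /(_ erefl) a0] [bb /(_ erefl) b0].
rewrite -/(qform Hyperbolic a a) in aa; rewrite -/(qform Hyperbolic b b) in bb.
pose y := b 0 0 *: a - a 0 0 *: b.
have yy : 0 <= qform Hyperbolic y y.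
  rewrite qformE; apply: sumr_ge0 => i _; rewrite /qsign; have [->|_] := eqVneq i 0.
    by rewrite !mxE (mulrC (b 0 0)) subrr !mul0r mulr0.
  by rewrite mul1r -expr2 sqr_ge0.
have : qform Hyperbolic y y = - (b 0 0 ^+ 2 + a 0 0 ^+ 2 + 2 * (a 0 0 * b 0 0) * qform Hyperbolic a b).
  rewrite /y !(qformBl, qformBr, qformZl, qformZr) aa bb (qformC Hyperbolic b a) /sgn.
  ring.
move=> yyE; rewrite ltNge; apply/negP => ab; move: yy; rewrite yyE oppr_ge0 leNgt => /negP; apply.
apply: ltr_wpDr; first by rewrite !mulr_ge0// ltW.
by rewrite addr_gt0// exprn_gt0.
Qed.

Lemma spherical_pairing_le1 (a b : vec) : quadric Spherical a -> quadric Spherical b ->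
  qform Spherical a b ^+ 2 <= 1.
Proof.
move=> qa [bb _]; have [aa _] := qa.
rewrite -/(qform Spherical a a) in aa; rewrite -/(qform Spherical b b) in bb.
pose c := b - qform Spherical a b *: a.
have ca : qform Spherical c a = 0.
  by rewrite /c qformBl qformZl aa /sgn mulr1 qformC subrr.
have [+ _] := quadric_normal_pos qa ca.
have -> : qform Spherical c c = 1 - qform Spherical a b ^+ 2.
  rewrite {2}/c qformBr qformZr ca mulr0 subr0 /c qformBl qformZl bb /sgn expr2.
  by [].
by rewrite subr_ge0.
Qed.

Variable s : space_form.
Local Notation sgn := (sgn R s).
Local Notation qform := (@qform R s n).
Local Notation inner := (@inner R s n).
Variables (M : set ambient) (N : ambient -> ambient) (o : vec).
Hypotheses (hM : embedded_hypersurface s M) (hN : unit_normal s M N).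
Hypotheses (ho : quadric s o) (hrot : rotational s o M).
Hypotheses (M_compact : compact M) (M_neq0 : M !=set0) (n_gt0 : (0 < n)%N).

Lemma adapted_frame_exists U phi x : local_param M U phi -> U x -> exists (E : 'M[R]_n) (d : 'rV[R]_n),
  [/\ E^T *m induced_metric s phi x *m E = 1%:M,
      E^T *m second_form s N phi x *m E = diag_mx d &
      shape_op s N phi x = invmx (induced_metric s phi x) *m second_form s N phi x].
Proof.
move=> hphi Ux.
have [E [d [EG EB]]] := simultaneous_diagonalization (metric_sym s phi x)
  (metric_posdef hM hphi Ux) (second_form_sym hN hphi Ux).
by exists E, d; split=> //; exact: (shape_opE N hM hphi Ux).
Qed.

(** The sum is the Laplacian of the barrier along a minimal hypersurface. In the
    hyperbolic case [<x,o>] is negative, which makes every summand positive. In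
    the spherical case the last terms may be negative; by [adapted_parseval] for
    [o] and for the vertical vector, the squares of the [<e_a, o>] add up to at
    least [(1 - <x,o>^2) (1 - delta)], where [delta] is the squared length of the tangential
    part of the vertical vector. *)
Lemma barrier_subharmonic (lam C : R) U phi x (E : 'M[R]_n) (d : 'rV[R]_n) :
  local_param M U phi -> U x ->
  E^T *m induced_metric s phi x *m E = 1%:M ->
  E^T *m second_form s N phi x *m E = diag_mx d ->
  0 < lam -> C = lam * (lam + 1) * expR lam ->
  (s = Spherical -> 0 < lam * (1 - qform (phi x).1 o ^+ 2) + n%:R * qform (phi x).1 o) ->
  forall e : 'I_n -> ambient, (forall a, e a = 'D_((col a E)^T) phi x) ->
  0 < \sum_a (lam ^+ 2 * expR (- lam * qform (phi x).1 o) * qform (e a).1 o ^+ 2 +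
    2 * C * (e a).2 ^+ 2 +
    sgn * lam * expR (- lam * qform (phi x).1 o) * qform (phi x).1 o * qform (e a).1 (e a).1).
Proof.
move=> hphi Ux EG EB lam0 CE l_pos e eE; set p := phi x.
have Mp : M p by exact: (param_in hphi).
have qp := hM.1 p Mp.
have [pp _] := qp; rewrite -/(qform p.1 p.1) in pp.
have tangent a : qform (e a).1 p.1 = 0 by rewrite eE; exact: (tangent_horizontal hM hphi).
have unit_e a : inner (e a) (e a) = 1.
  by have := adapted_orthonormal hphi Ux EG a a; rewrite eqxx eE.
have parseval w : inner w w =
    sgn * qform w.1 p.1 ^+ 2 + inner w (N p) ^+ 2 + \sum_a inner w (e a) ^+ 2.
  have := adapted_parseval hM hN hphi Ux EG w; rewrite -/p => ->.
  by congr (_ + _); apply: eq_bigr => a _; rewrite eE.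
have NN : inner (N p) (N p) = 1 by have [_ _ N1 _] := hN; exact: N1.
have Np : qform (N p).1 p.1 = 0 by exact: (normal_horizontal hM hN).
move: l_pos; rewrite -/p; set l := qform p.1 o => l_pos; set g := expR (- lam * l).
clearbody p; clear eE EG EB.
have g0 : 0 < g by exact: expR_gt0.
have C0 : 0 < C by rewrite CE !mulr_gt0 ?expR_gt0// addr_gt0.
have qh a : qform (e a).1 (e a).1 + (e a).2 ^+ 2 = 1.
  by rewrite -(unit_e a) innerE expr2.
have q0 a : 0 <= qform (e a).1 (e a).1 by have [] := quadric_normal_pos qp (tangent a).
have [[sgnE l_neg]|[sgnE l_cond]] : sgn = -1 /\ l < 0 \/
    sgn = 1 /\ 0 < lam * (1 - l ^+ 2) + n%:R * l.
- move: l_pos; rewrite /l; move: qp ho; rewrite /Defs.sgn; case: s => qp' ho' l_pos.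
    by left; split=> //; exact: hyperboloid_pairing_lt0.
  by right; split=> //; exact: l_pos.
- have term_gt0 a : 0 < lam ^+ 2 * g * qform (e a).1 o ^+ 2 +
      2 * C * (e a).2 ^+ 2 + sgn * lam * g * l * qform (e a).1 (e a).1.
    have A0 : 0 <= lam ^+ 2 * g * qform (e a).1 o ^+ 2.
      by apply: mulr_ge0; [apply: mulr_ge0; [exact: sqr_ge0|exact: ltW]|exact: sqr_ge0].
    have K0 : 0 < lam * g * - l by rewrite !mulr_gt0// oppr_gt0.
    have -> : sgn * lam * g * l * qform (e a).1 (e a).1 =
        lam * g * - l * qform (e a).1 (e a).1 by rewrite sgnE; ring.
    rewrite -addrA; apply: ltr_wpDl => //.
    have B0 : 0 <= lam * g * - l * qform (e a).1 (e a).1 by rewrite mulr_ge0// ltW.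
    have [h0|h_neq0] := eqVneq ((e a).2 ^+ 2) 0.
      have q1 : qform (e a).1 (e a).1 = 1 by rewrite -(qh a) h0 addr0.
      by rewrite h0 mulr0 add0r q1 mulr1.
    apply: ltr_pwDl => //; rewrite mulr_gt0//; first by rewrite mulr_gt0.
    by rewrite lt_def h_neq0 sqr_ge0.
  rewrite (bigD1 (Ordinal n_gt0))//=; apply: ltr_pwDl; first exact: term_gt0.
  by apply: sumr_ge0 => a _; exact/ltW/term_gt0.
have delta_eq : \sum_a (e a).2 ^+ 2 = 1 - (N p).2 ^+ 2.
  have vert w : inner ((0, 1) : ambient) w = w.2.
    by rewrite innerE [X in X + _](@qform0l R s n) add0r [LHS]mul1r.
  have := parseval ((0, 1) : ambient); rewrite !vert [qform _ _](@qform0l R s n).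
  rewrite expr0n mulr0 add0r [((0, 1) : ambient).2]/= => ->.
  by rewrite addrC addKr; apply: eq_bigr => a _; rewrite vert.
set delta := \sum_a (e a).2 ^+ 2 in delta_eq.
have [oo _] := ho; rewrite -/(qform o o) in oo.
have L_eq : \sum_a qform (e a).1 o ^+ 2 = 1 - l ^+ 2 - qform (N p).1 o ^+ 2.
  have := parseval ((o, 0) : ambient).
  rewrite inner_horizontal oo sgnE mul1r (innerC s _ (N p)) inner_horizontal.
  rewrite [((o, 0) : ambient).1]/= (qformC s o) -/l.
  have -> : \sum_a inner (o, 0) (e a) ^+ 2 = \sum_a qform (e a).1 o ^+ 2.
    by apply: eq_bigr => a _; rewrite innerC inner_horizontal.
  by move=> h; lra.
pose o' := o - l *: p.1.
have o'p : qform o' p.1 = 0.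
  by rewrite /o' qformBl qformZl pp sgnE mulr1 (qformC s o) -/l subrr.
have o'o' : qform o' o' = 1 - l ^+ 2.
  rewrite {2}/o' qformBr qformZr o'p mulr0 subr0 /o' qformBl qformZl oo sgnE -/l expr2.
  by [].
have No' : qform (N p).1 o' = qform (N p).1 o.
  by rewrite /o' qformBr qformZr Np mulr0 subr0.
have NhNh : qform (N p).1 (N p).1 = delta.
  by rewrite delta_eq -NN innerE expr2 addrK.
have := quadric_normal_CS qp Np o'p; rewrite No' NhNh o'o' => CS.
have [l1 _] := quadric_normal_pos qp o'p; rewrite o'o' subr_ge0 in l1.
have -> : \sum_a (lam ^+ 2 * g * qform (e a).1 o ^+ 2 + 2 * C * (e a).2 ^+ 2 +
    sgn * lam * g * l * qform (e a).1 (e a).1) =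
  lam ^+ 2 * g * (\sum_a qform (e a).1 o ^+ 2) + 2 * C * delta + lam * g * l * (n%:R - delta).
  rewrite !big_split/= -!mulr_sumr sgnE mul1r; congr (_ + _ * _).
  transitivity (\sum_a (1 - (e a).2 ^+ 2)).
    by apply: eq_bigr => a _; rewrite -(qh a) addrK.
  by rewrite big_split/= sumr_const card_ord sumrN.
apply: (@spherical_estimate R lam g (expR lam)) => //.
- rewrite ler_expR mulNr; have : - l <= 1 by nra.
  by move=> l_ge; rewrite -mulrN ler_piMr// ltW.
- by apply: sumr_ge0 => a _; exact: sqr_ge0.
- by rewrite L_eq; nra.
Qed.

(** The barrier attains its maximum on [M], and its Laplacian is nonpositive
    there. In the spherical case the parameter [lam] exists because [<x,o>] is
    bounded below on [M] by a constant greater than -1, as [M] does not meet the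
    antipodal line; the slices, which are minimal, do. *)
Theorem no_minimal_sphere :
  ~ (forall U phi, local_param M U phi -> forall x, U x -> mean_curv (shape_op s N phi x) 1 = 0).
Proof.
move=> min0.
have max_on_M lam C : exists2 p, M p &
    forall q, M q -> barrier s o lam C q <= barrier s o lam C p.
  have [|p /set_mem Mp pmax] := compact_EVT_max (f := barrier s o lam C) M_neq0 M_compact.
    exact/continuous_subspaceT/barrier_continuous.
  by exists p => // q Mq; apply: pmax; exact: mem_set.
have [lam lam0 lam_cond] : exists2 lam : R, 0 < lam & forall p, M p ->
    s = Spherical -> 0 < lam * (1 - qform p.1 o ^+ 2) + n%:R * qform p.1 o.
  (* A maximum of this barrier is a minimum of [<x,o>]. *)
  move: (max_on_M 1 0) => [p0 Mp0 p0_max].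
  have l_min p : M p -> qform p0.1 o <= qform p.1 o.
    move=> Mp; have := p0_max p Mp.
    by rewrite /barrier !mul0r !addr0 ler_expR !mulN1r lerN2.
  have l_gt : s = Spherical -> -1 < qform p0.1 o.
    move=> sS; have oo : qform o o = 1 by case: ho => -> _; rewrite /Defs.sgn sS.
    have [->|[rho [t [rho0 rho_pi [v [vo _ ->]] _]]]] := hrot Mp0.
      by rewrite oo; lra.
    rewrite sS /geodesic -sS [(_, _).1]/= qformDl !qformZl oo vo mulr0 addr0 mulr1.
    rewrite -(cospi R) ltr_cos ?in_itv/= ?rho_pi ?pi_ge0 ?lexx// ltW//=.
    by rewrite ltW// rho_pi.
  have l_cond (lam : R) p : M p -> s = Spherical -> lam * (1 + qform p0.1 o) = n%:R + 1 -> 0 < lam ->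
      0 < lam * (1 - qform p.1 o ^+ 2) + n%:R * qform p.1 o.
    move=> Mp sS lamE lam0; have l0 := l_min p Mp; have l1 := l_gt sS.
    have l2 : qform p.1 o ^+ 2 <= 1.
      by move: (hM.1 p Mp) ho; rewrite sS => qp qo; exact: spherical_pairing_le1.
    have n0 : 0 < n%:R :> R by rewrite ltr0n.
    move: l0 l1 l2 lamE; set l := qform p.1 o; set l0 := qform p0.1 o => ll0 l01 l2 lamE.
    have [l_gt0|l_le0] := ltP 0 l.
      by rewrite ltr_wpDl// ?mulr_gt0// mulr_ge0// ?subr_ge0// ltW.
    have h1 : lam * (1 + l0) <= lam * (1 + l) by rewrite ler_pM2l//; lra.
    have h2 : lam * (1 + l) <= lam * (1 - l ^+ 2) by rewrite ler_pM2l//; nra.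
    have h3 : - n%:R <= n%:R * l :> R by rewrite -mulrN1 ler_pM2l//; lra.
    by lra.
  case: (pselect (s = Spherical)) => [sS|sH]; last by exists 1 => // p _ /sH.
  have lam0 : 0 < (n%:R + 1) / (1 + qform p0.1 o).
    by apply: divr_gt0; [rewrite ltr_wpDl | have := l_gt sS; lra].
  exists ((n%:R + 1) / (1 + qform p0.1 o)) => // p Mp _; apply: l_cond => //.
  by rewrite divfK// gt_eqF//; have := l_gt sS; lra.
have [p Mp p_max] := max_on_M lam (lam * (lam + 1) * expR lam).
have [U [phi [x [hphi Ux phix]]]] := hM.2 p Mp.
have [E [d [EG EB AE]]] := adapted_frame_exists hphi Ux.
have d0 : \sum_a d 0 a = 0.
  by rewrite -(pencil_mean_curv1 EG EB) -AE; exact: min0 hphi _ Ux.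
rewrite -phix in p_max Mp.
have := barrier_second_variation hM hN hphi Ux EG EB p_max d0.
rewrite leNgt => /negP; apply.
by apply: (barrier_subharmonic hphi Ux EG EB lam0 erefl (lam_cond _ Mp)).
Qed.

End NoMinimalSphere.

(** * Instability *)

Section JacobiTerm.
Variables (R : realType) (n : nat).
Local Notation ambient := (ambient R n).

(** Nonnegativity, on each principal direction, of the quadratic form of the
    square of the shape operator plus the ambient curvature. In the spherical
    case the curvature itself is nonnegative by Cauchy-Schwarz. *)
Lemma jacobi_term (s : space_form) (M : set ambient) (N : ambient -> ambient) (o : vec R n)
    (U : set 'rV[R]_n) (phi : 'rV[R]_n -> ambient) x (E : 'M[R]_n) (d : 'rV[R]_n) i :
  embedded_hypersurface s M -> unit_normal s M N -> quadric s o -> rotational s o M ->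
  local_param M U phi -> U x ->
  E^T *m induced_metric s phi x *m E = 1%:M ->
  E^T *m second_form s N phi x *m E = diag_mx d ->
  forall K, K = qform s (N (phi x)).1 (N (phi x)).1 *
      qform s ('D_((col i E)^T) phi x).1 ('D_((col i E)^T) phi x).1 -
      qform s (N (phi x)).1 ('D_((col i E)^T) phi x).1 ^+ 2 ->
  0 <= d 0 i ^+ 2 + sgn R s * K /\ (d 0 i ^+ 2 + sgn R s * K = 0 -> d 0 i = 0).
Proof.
case: s => hM hN ho hrot hphi Ux EG EB K ->.
  rewrite [sgn _ _]/= mulN1r.
  exact: (hyperbolic_jacobi_term hM hN ho hrot hphi Ux i EG EB).
rewrite [sgn _ _]/= mul1r.
have Mp : M (phi x) by exact: (param_in hphi).
have CS := quadric_normal_CS (hM.1 _ Mp) (normal_horizontal hM hN Mp)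
  (tangent_horizontal hM hphi (col i E)^T Ux).
rewrite -subr_ge0 in CS; have d2 := sqr_ge0 (d 0 i).
split; first exact: addr_ge0.
by move/eqP; rewrite paddr_eq0// sqrf_eq0 => /andP[/eqP].
Qed.

End JacobiTerm.

Section StabilityAtMinimum.
Variables (R : realType) (s : space_form) (n : nat).
Local Notation ambient := (ambient R n).
Variables (M : set ambient).
Hypotheses (hM : embedded_hypersurface s M).
Variables (U : set 'rV[R]_n) (phi : 'rV[R]_n -> ambient) (x : 'rV[R]_n).
Hypotheses (hphi : local_param M U phi) (Ux : U x).

(** The first derivatives vanish at a minimum on [M], so the Christoffel symbols
    do not contribute. *)
Lemma hess_form_min (u : ambient -> R^o) (E : 'M[R]_n) a : smooth_map M u ->
  (forall q, M q -> u (phi x) <= u q) ->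
  0 <= (E^T *m hess_form s phi (u \o phi) x *m E) a a.
Proof.
move=> su u_min.
have [U' [oU' U'x U'U CF]] := smooth_on_param hphi (real_frame R) su Ux.
have u_min' y : U' y -> (u \o phi) x <= (u \o phi) y.
  by move=> /U'U Uy; apply: u_min; exact: (param_in hphi).
have test w := second_derivative_test w oU' (CF 2%N) U'x u_min'.
rewrite congruence_entry.
have := (test (col a E)^T).2.
rewrite (second_derive_frame (rV_frame R n) oU' (CF 2%N) U'x) => /le_trans; apply.
rewrite le_eqVlt; apply/orP; left; apply/eqP.
apply: eq_bigr => i _; apply: eq_bigr => j _.
rewrite big1 ?subr0; last by move=> k _; rewrite /partial (test _).1 mulr0.
by rewrite /= /rV_coord !mxE.
Qed.

End StabilityAtMinimum.

Theorem theorem4p7 (R : realType) (s : space_form) (n r : nat) (hr : (r < n)%N)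
    (o : vec R n) (ho : quadric s o)
    (M : set (ambient R n)) (N : ambient R n -> ambient R n)
    (hM : embedded_hypersurface s M) (hN : unit_normal s M N)
    (hrot : rotational s o M) (hsph : diffeomorphic M (unit_sphere R n))
    (hH : constant_mean_curv s M N r.+1)
    (hP : newton_posdef s M N r) :
  ~ stable s M N r.
Proof.
move=> [u [su u_gt0 stab]].
have n_gt0 : (0 < n)%N by exact: leq_ltn_trans hr.
have [M_compact M_neq0] := sphere_compact hsph.
have [|p /set_mem Mp p_min] := compact_EVT_min (f := u) M_neq0 M_compact.
  exact: smooth_map_continuous.
have u_min q : M q -> u p <= u q by move=> Mq; apply: p_min; exact: mem_set.
have [U [phi [x [hphi Ux phix]]]] := hM.2 p Mp.
have [E [d [EG EB AE]]] := adapted_frame_exists hM hN hphi Ux.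
set G := induced_metric s phi x in EG AE; set B := second_form s N phi x in EB AE.
set A := shape_op s N phi x in AE.
have A_eigen : A *m E = E *m diag_mx d by rewrite AE; exact: (pencil_eigen EG EB).
have [pp PE] := newton_eigen r A_eigen.
have pp_gt0 a : 0 < pp 0 a.
  apply: (pencil_posdef_gt0 EG PE) => v v0.
  by rewrite mulmxA; exact: (hP U phi hphi x Ux v v0).
have [C [CE C_diag]] := curvature_opE hM hN hphi Ux E.
have hess_ge0 a : 0 <= (E^T *m hess_form s phi (u \o phi) x *m E) a a.
  by apply: (hess_form_min s hphi Ux) => // q Mq; rewrite phix; exact: u_min.
pose K a := qform s (N (phi x)).1 (N (phi x)).1 *
      qform s ('D_((col a E)^T) phi x).1 ('D_((col a E)^T) phi x).1 -
      qform s (N (phi x)).1 ('D_((col a E)^T) phi x).1 ^+ 2.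
have term a := jacobi_term hM hN ho hrot hphi Ux EG EB (erefl (K a)).
have d0 a : d 0 a = 0.
  apply: (term a).2.
  have := stab U phi hphi x Ux; rewrite /stability_op -/A CE /hess_op -/G.
  have -> : A *m A = invmx G *m B *m (invmx G *m B) by rewrite -AE.
  rewrite (pencil_tr_form EG PE) (pencil_tr_form EG PE) (pencil_tr_sqr EG EB PE).
  rewrite -addrA -mulrDl -big_split/= phix => stab_le0.
  have stab_le : (\sum_b (pp 0 b * d 0 b ^+ 2 + pp 0 b * (E^T *m C *m E) b b)) * u p <= 0.
    apply: le_trans stab_le0; rewrite lerDr; apply: sumr_ge0 => b _.
    by rewrite mulr_ge0// ltW.
  have jacobi_ge0 b : 0 <= pp 0 b * d 0 b ^+ 2 + pp 0 b * (E^T *m C *m E) b b.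
    by rewrite -mulrDr C_diag mulr_ge0// ?(ltW (pp_gt0 b))//; exact: (term b).1.
  have sum0 : \sum_b (pp 0 b * d 0 b ^+ 2 + pp 0 b * (E^T *m C *m E) b b) = 0.
    apply/eqP; rewrite eq_le sumr_ge0 ?andbT//.
    by rewrite -(pmulr_lle0 _ (u_gt0 p Mp)).
  move/eqP: sum0; rewrite psumr_eq0// => /allP/(_ a (mem_index_enum _)) /=.
  by rewrite -mulrDr C_diag mulf_eq0 (gt_eqF (pp_gt0 a))/= => /eqP.
have A0 : A = 0.
  have : A *m E = 0.
    rewrite A_eigen (_ : d = 0) ?raddf0 ?mulmx0//.
    by apply/rowP => a; rewrite d0 mxE.
  move/(congr1 (mulmx^~ (invmx E))).
  by rewrite mulmxK ?mul0mx// (pencil_unitmx EG).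
case: r hr hH hP {stab PE} => [|r] hr hH hP.
  have [c cE] := hH; apply: (no_minimal_sphere hM hN ho hrot M_compact M_neq0 n_gt0).
  move=> U' phi' hphi' x' U'x'; rewrite (cE _ _ hphi' _ U'x') -(cE _ _ hphi _ Ux).
  by rewrite -/A A0 mean_curv0.
have := hP U phi hphi x Ux (delta_mx (Ordinal n_gt0) 0).
rewrite -/A A0 newton0 mulmx0 mul0mx mxE ltxx => contra.
suff /contra : (delta_mx (Ordinal n_gt0) 0 : 'cV[R]_n) != 0 by [].
apply/eqP => /matrixP/(_ (Ordinal n_gt0) 0); rewrite !mxE !eqxx => /eqP.
by rewrite oner_eq0.
Qed.
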